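(* Let $m,n,s,k$ be positive integers with $m+s=n+k$, and let $\mathbf{a}=(a_1,\ldots,a_s)$, $\mathbf{b}=(b_1,\ldots,b_k)$, $\mathbf{c}=(c_1,\ldots,c_n)$, $\mathbf{d}=(d_1,\ldots,d_m)$ be partitions (nonincreasing sequences of integers) such that $c_i\neq d_j$ for all $i\in\{1,\ldots,n\}$, $j\in\{1,\ldots,m\}$. Let $S,\Delta$, $h,h'$, $c^1\ge\cdots\ge c^{h'}$, $d^1\ge\cdots\ge d^{h}$, $m_y,t_y,z_y$, $m'_x,t'_x,z'_x$, $\mathbf{e}$, $\mathbf{e}'$ be as defined in the context. Then there exists a partition $\mathbf{g}=(g_1,\ldots,g_{m+s})$ such that $\mathbf{g}\prec''(\mathbf{d},\mathbf{a})$ and $\mathbf{g}\prec''(\mathbf{c},\mathbf{b})$ if and only if the following two conditions hold: (i) for every $y\in\{1,\ldots,h'\}$ with $t_y\le m_y$, $$\sum_{i=z_y+t_y}^{z_y+m_y}e_i\le \sum_{i=y}^{h'} c^i-\sum_{i\ge z_y+1,\ i\notin \Delta }d_i-\sum_{i=m_y+1}^s a_i;$$ (ii) for every $x\in\{1,\ldots,h\}$ with $t'_x\le m'_x$, $$\sum_{i=z'_x+t'_x}^{z'_x+m'_x}e'_i\le \sum_{i=x}^{h} d^i-\sum_{i\ge z'_x+1,\ i\notin S }c_i-\sum_{i=m'_x+1}^k b_i.$$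
   Context: Conventions: for any finite sequence $y_1,\ldots,y_w$, $\sum_{i=r}^{s}y_i=0$ if $r>s$, $y_i=+\infty$ for $i\le 0$ and $y_i=-\infty$ for $i>w$. Weak generalized majorization: for partitions $\mathbf{d}=(d_1,\ldots,d_m)$, $\mathbf{a}=(a_1,\ldots,a_s)$, $\mathbf{g}=(g_1,\ldots,g_{m+s})$, put $h_j:=\min\{i\mid d_{i-j+1}<g_i\}$ for $j=1,\ldots,s$. We write $\mathbf{g}\prec''(\mathbf{d},\mathbf{a})$ if (1) $d_i\ge g_{i+s}$ for $i=1,\ldots,m$; (2) $\sum_{i=h_j+1}^{m+s}g_i\ge\sum_{i=h_j-j+1}^{m}d_i+\sum_{i=j+1}^{s}a_i$ for $j=1,\ldots,s$; (3) $\sum_{i=1}^{m+s}g_i\ge\sum_{i=1}^m d_i+\sum_{i=1}^s a_i$. The relation $\mathbf{g}\prec''(\mathbf{c},\mathbf{b})$ is defined in the same way with $(\mathbf{c},\mathbf{b},n,k)$ in place of $(\mathbf{d},\mathbf{a},m,s)$. Unions: $\mathbf{e}=(e_1,\ldots,e_{m+s})$ is the nonincreasing rearrangement of $d_1,\ldots,d_m,a_1,\ldots,a_s$, where whenever some $a$'s equal some $d$'s, all those equal $a$'s are placed before the equal $d$'s. Similarly $\mathbf{e}'=(e'_1,\ldots,e'_{n+k})$ is the nonincreasing rearrangement of $c_1,\ldots,c_n,b_1,\ldots,b_k$, with equal $b$'s placed before equal $c$'s. Sets $S\subseteq\{1,\ldots,n\}$ and $\Delta\subseteq\{1,\ldots,m\}$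 are defined inductively. Start with both empty and process the elements of the multiset $\{c_1,\ldots,c_n\}\cup\{d_1,\ldots,d_m\}$ one at a time from the smallest to the largest; among equal $c$'s (resp. equal $d$'s) the one with largest index is processed first. At each step ''$i\notin\Delta$'' (resp. ''$i\notin S$'') refers to already processed indices not placed in $\Delta$ (resp. $S$), and $S,\Delta$ denote their current contents. If the processed element is $d_j$: set $q_j:=s-\#\{i\in S\mid c_i<d_j\}+\#\{i>j\mid i\notin\Delta\}+1$. If $q_j>s$, put $j\in\Delta$. If $q_j\le s$, let $l\in S$ be the minimal index with $d_j>c_l$ and let $N:=\#\{i\mid a_i>c_l\}-s+\#\{i\in S\mid i>l\}-\#\{i\notin\Delta\mid d_i<c_l\}+1$. (a) If $N\ge 1$ and $d_j$ is among the $N$ smallest entries of $\mathbf{e}$ that are bigger than $c_l$, put $j\notin\Delta$. (b) Otherwise, put $j\notin\Delta$ if $\sum_{c_i<d_j,\,i\in S}c_i\ge\sum_{i\notin\Delta,\,i>j}d_i+d_j+\sum_{i=q_j+1}^s a_i$, and put $j\in\Delta$ if this inequality fails. If the processed element is $c_j$: dually, set $q'_j:=k-\#\{i\in\Delta\mid d_i<c_j\}+\#\{i>j\mid i\notin S\}+1$. If $q'_j>k$, put $j\in S$. If $q'_j\le k$, let $l\in\Delta$ be the minimal index with $c_j>d_l$ and $N':=\#\{i\mid b_i>d_l\}-k+\#\{i\in\Delta\mid i>l\}-\#\{i\notin S\mid c_i<d_l\}+1$. (a) If $N'\ge1$ and $c_j$ is among the $N'$ smallest entries of $\mathbf{e}'$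 bigger than $d_l$, put $j\notin S$. (b) Otherwise put $j\notin S$ if $\sum_{d_i<c_j,\,i\in\Delta}d_i\ge\sum_{i\notin S,\,i>j}c_i+c_j+\sum_{i=q'_j+1}^k b_i$, and $j\in S$ if it fails. After the construction, let $h=\#\Delta$, $h'=\#S$; let $d^1\ge\cdots\ge d^h$ be the $d_i$ with $i\in\Delta$ and $c^1\ge\cdots\ge c^{h'}$ the $c_i$ with $i\in S$ (in order of indices). For $j=1,\ldots,h'$: $m_j:=\#\{i\mid a_i>c^j\}$, $t_j:=s-(h'-j)+\#\{i\notin\Delta\mid d_i<c^j\}$, $z_j:=\#\{i\mid d_i>c^j\}$. For $j=1,\ldots,h$: $m'_j:=\#\{i\mid b_i>d^j\}$, $t'_j:=k-(h-j)+\#\{i\notin S\mid c_i<d^j\}$, $z'_j:=\#\{i\mid c_i>d^j\}$. Here $i\notin\Delta$ means $i\in\{1,\ldots,m\}\setminus\Delta$ and $i\notin S$ means $i\in\{1,\ldots,n\}\setminus S$. *)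

(* Defs.v *)
(* Sequences are 1-indexed: [entry w i] = w_i for 1 <= i <= size w. *)
From HB Require Import structures.
From mathcomp Require Import all_boot all_order all_algebra.
Set Implicit Arguments.
Unset Strict Implicit.
Unset Printing Implicit Defensive.
Import Order.TTheory GRing.Theory Num.Theory.
Local Open Scope ring_scope.

(** 1-based access, meaningful for 1 <= i <= size w *)
Definition entry (w : seq int) (i : nat) : int := nth 0 w i.-1.

(** \sum_{i=r}^{t} w_i, used only when all indices lie in 1..size w (or range empty) *)
Definition sumI (w : seq int) (r t : nat) : int := \sum_(r <= i < t.+1) entry w i.

Definition sumP (w : seq int) (P : pred nat) : int :=
  \sum_(i <- iota 1 (size w) | P i) entry w i.

Definition cnt (n : nat) (P : pred nat) : nat := count P (iota 1 n).

(** Extended integers, for the conventions y_i = +oo (i <= 0), y_i = -oo (i > w). *)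
Inductive ext := NInf | Fin of int | PInf.

Definition leE (x y : ext) : bool :=
  match x, y with
  | NInf, _ => true
  | _, PInf => true
  | Fin a, Fin b => a <= b
  | _, _ => false
  end.

Definition ltE (x y : ext) : bool :=
  match x, y with
  | NInf, NInf => false
  | NInf, _ => true
  | Fin a, Fin b => a < b
  | Fin _, PInf => true
  | _, _ => false
  end.

Definition atE (w : seq int) (i : int) : ext :=
  if i <= 0 then PInf
  else if (size w)%:Z < i then NInf
  else Fin (nth 0 w (absz i).-1).

Definition sumE (w : seq int) (r t : int) : ext :=
  if t < r then Fin 0
  else if r <= 0 then PInf
  else if (size w)%:Z < t then NInf
  else Fin (sumI w (absz r) (absz t)).

Definition addFE (x : int) (e : ext) : ext :=
  match e with Fin y => Fin (x + y) | e' => e' end.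

Definition is_partition (w : seq int) : bool := sorted (fun x y : int => y <= x) w.

(** h_j := min { i | d_{i-j+1} < g_i }  (outside 1..size g, g_i = +-oo so the
    inequality fails; hence the search over 1..size g) *)
Definition h_idx (g d : seq int) (j : nat) : nat :=
  (find (fun i : nat => ltE (atE d (i%:Z - j%:Z + 1)) (atE g i%:Z))
        (iota 1 (size g))).+1.

Definition weak_major (g d a : seq int) : Prop :=
  let m := size d in let s := size a in
  [/\ size g = (m + s)%N,
      (forall i, (1 <= i <= m)%N -> entry g (i + s) <= entry d i),
      (forall j, (1 <= j <= s)%N ->
          sumI d (h_idx g d j - j + 1) m + sumI a j.+1 s
            <= sumI g (h_idx g d j).+1 (m + s)) &
      sumI d 1 m + sumI a 1 s <= sumI g 1 (m + s)].

(** The union e of u (e.g. a) and x (e.g. d), as tagged entries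
    (value, (is_x, index)): nonincreasing; on ties u-entries come before
    x-entries; among equal entries of the same sequence, by increasing index. *)
Definition ecmp (p q : int * (bool * nat)) : bool :=
  (q.1 < p.1) ||
  ((p.1 == q.1) && ((~~ p.2.1 && q.2.1) || ((p.2.1 == q.2.1) && (p.2.2 <= q.2.2)%N))).

Definition etag (u x : seq int) : seq (int * (bool * nat)) :=
  sort ecmp ([seq (entry u i, (false, i)) | i <- iota 1 (size u)]
             ++ [seq (entry x i, (true, i)) | i <- iota 1 (size x)]).

Definition evals (u x : seq int) : seq int := map fst (etag u x).

(** One step of the construction of S, Delta: processing x_j (x = d, X = Delta,
    y = c, Y = S, u = a; or dually x = c, X = S, y = d, Y = Delta, u = b).
    Processed x-indices are exactly those > j.  Returns true iff j is put in X. *)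
Definition decide (x : seq int) (X : seq nat) (y : seq int) (Y : seq nat)
    (u : seq int) (j : nat) : bool :=
  let s := size u in
  let xj := entry x j in
  let notX := fun i : nat => (j < i)%N && (i \notin X) in
  let q : int := s%:Z - (cnt (size y) (fun i => (i \in Y) && (entry y i < xj)))%:Z
                 + (cnt (size x) notX)%:Z + 1 in
  if s%:Z < q then true else
  let l := nth 0%N [seq i <- iota 1 (size y) | (i \in Y) && (entry y i < xj)] 0 in
  let yl := entry y l in
  let N : int := (count (fun v => yl < v) u)%:Z - s%:Z
                 + (cnt (size y) (fun i => (i \in Y) && (l < i)%N))%:Z
                 - (cnt (size x) (fun i => notX i && (entry x i < yl)))%:Z + 1 in
  let L := [seq p <- etag u x | yl < p.1] in
  if (1 <= N) && ((xj, (true, j)) \in drop (size L - absz N) L) then false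
  else ~~ leE (addFE (sumP x notX + xj) (sumE u (q + 1) s%:Z))
              (Fin (sumP y (fun i => (i \in Y) && (entry y i < xj)))).

(** Process the c's and d's from smallest to largest; ic (resp. id) is the
    number of still unprocessed c's (resp. d's): c_1..c_ic, d_1..d_id. *)
Fixpoint run (c d a b : seq int) (fuel ic id : nat) (S D : seq nat)
    {struct fuel} : seq nat * seq nat :=
  match fuel with
  | 0 => (S, D)
  | f.+1 =>
    if (ic == 0%N) && (id == 0%N) then (S, D)
    else if (id == 0%N) || ((ic != 0%N) && (entry c ic < entry d id)) then
      run c d a b f ic.-1 id (if decide c S d D b ic then ic :: S else S) D
    else
      run c d a b f ic id.-1 S (if decide d D c S a id then id :: D else D)
  end.

Definition SDelta (c d a b : seq int) : seq nat * seq nat :=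
  run c d a b (size c + size d) (size c) (size d) [::] [::].

Definition Sfin (c d a b : seq int) : seq nat :=
  [seq i <- iota 1 (size c) | i \in (SDelta c d a b).1].
Definition Dfin (c d a b : seq int) : seq nat :=
  [seq i <- iota 1 (size d) | i \in (SDelta c d a b).2].

(** Condition (i) with w = c, W = S, v = d, V = Delta, u = a, es = e;
    condition (ii) with w = d, W = Delta, v = c, V = S, u = b, es = e'.
    w^y = w_{(y-th smallest index of W)}. *)
Definition cond (w : seq int) (W : seq nat) (v : seq int) (V : seq nat)
    (u : seq int) (es : seq int) : Prop :=
  forall y : nat, (1 <= y <= size W)%N ->
    let wy := entry w (nth 0%N W y.-1) in
    let my := count (fun z => wy < z) u in
    let ty : int := (size u)%:Z - (size W - y)%:Z
                    + (cnt (size v) (fun i => (i \notin V) && (entry v i < wy)))%:Z in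
    let zy := count (fun z => wy < z) v in
    ty <= my%:Z ->
    leE (sumE es (zy%:Z + ty) (zy + my)%:Z)
        (Fin (\sum_(y <= i < (size W).+1) entry w (nth 0%N W i.-1)
              - sumP v (fun i => (zy < i)%N && (i \notin V))
              - sumI u my.+1 (size u))).

(* Main.v *)
(* Write K_w(x) and T_w(x) for the number of entries v <= x of w and for the sum
   of x - v over them, and put phi(x) = s - K_g(x) + K_d(x) and
   psi_j(x) = sum_(i > j) (x - a_i) + T_d(x) - T_g(x), so that
   psi_j(x + 1) - psi_j(x) = phi(x) - j.  Then g is weakly majorized by (d, a) iff
   phi <= s, psi_0 >= 0 near infinity, and psi_j(X_j) >= 0 for 1 <= j <= s, where X_j is
   the threshold past which phi stays below j.
   The sets S and Delta trace, from the smallest values upwards, the largest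
   possible tail of g: it consists of the c_i, i in S, and the d_i, i in Delta,
   and a d_j is left out exactly when phi may rise to q_j there, that is, when
   a_(q_j) >= d_j (this is what rule (a) amounts to) or psi_(q_j)(d_j) >= 0.
   Every admissible g has at least as many entries <= x as this tail, for all x.
   Conditions (i) and (ii) say that the tail is dominated by the unions of d, a
   and of c, b, in the sense of T; this is necessary by the previous remark,
   and sufficient because the tail can then be completed by large entries. *)
Require Import Defs.
From HB Require Import structures.
From mathcomp Require Import all_boot all_order all_algebra.
From mathcomp Require Import zify.
Import Order.TTheory GRing.Theory Num.Theory.
Local Open Scope ring_scope.

Implicit Types (w a b c d g e : seq int) (x y t u v : int).

Local Notation nthz := (nth (0 : int)).

(** * Counting functions and excess *)

Definition countle (w : seq int) (x : int) : nat := count (fun v => v <= x) w.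

Definition excess (w : seq int) (x : int) : int := \sum_(v <- w | v <= x) (x - v).

Lemma int_ind_above (P : int -> Prop) (x : int) :
  P x -> (forall t, x <= t -> P t -> P (t + 1)) -> forall y, x <= y -> P y.
Proof.
move=> P0 PS y le_xy; have -> : y = x + (absz (y - x))%:Z by lia.
elim: (absz _) => [|n IH]; first by rewrite addr0.
have -> : x + n.+1%:Z = x + n%:Z + 1 by lia.
by apply: PS IH; lia.
Qed.

Lemma countle_cat w w' x : countle (w ++ w') x = (countle w x + countle w' x)%N.
Proof. exact: count_cat. Qed.

Lemma excess_cat w w' x : excess (w ++ w') x = excess w x + excess w' x.
Proof. by rewrite /excess big_cat. Qed.

Lemma countle_perm w w' x : perm_eq w w' -> countle w x = countle w' x.
Proof. by move/permP; apply. Qed.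

Lemma excess_perm w w' x : perm_eq w w' -> excess w x = excess w' x.
Proof. exact: perm_big. Qed.

Lemma excess_cons v w x :
  excess (v :: w) x = (if v <= x then x - v else 0) + excess w x.
Proof. by rewrite /excess big_cons; case: ifP; rewrite ?add0r. Qed.

Lemma excessS w x : excess w (x + 1) = excess w x + (countle w x)%:Z.
Proof.
elim: w => [|v w IH]; first by rewrite /excess !big_nil.
by rewrite !excess_cons IH /countle /=; do 2 case: ifP; lia.
Qed.

Lemma countle_leq_size w x : (countle w x <= size w)%N.
Proof. exact: count_size. Qed.

Lemma countle_homo w x y : x <= y -> (countle w x <= countle w y)%N.
Proof. by move=> le_xy; apply: sub_count => v /= /le_trans; apply. Qed.

Lemma countle_gt w x : (countle w x + count (fun v => x < v)%R w = size w)%N.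
Proof.
rewrite -(count_predC (fun v => v <= x) w); congr addn.
by apply: eq_count => v /=; rewrite ltNge.
Qed.

Lemma countle_all w x : all (fun v => v <= x) w -> countle w x = size w.
Proof. by rewrite all_count => /eqP. Qed.

Lemma countle_none w x : all (fun v => x < v) w -> countle w x = 0%N.
Proof. by rewrite all_count => /eqP h; have := countle_gt w x; lia. Qed.

Lemma excess_none w x : all (fun v => x <= v) w -> excess w x = 0.
Proof.
move=> /allP h; rewrite /excess big_seq_cond big1 // => v /andP[/h]; lia.
Qed.

(* Discrete integration of [excessS]. *)
Lemma excess_le w w' x :
  (forall t, t < x -> (countle w t <= countle w' t)%N) -> excess w x <= excess w' x.
Proof.
move=> le_below.
have [x0 le_x0 /andP[/excess_none w0 /excess_none w'0]] :
  exists2 x0, x0 <= x & all (fun v => x0 <= v) w && all (fun v => x0 <= v) w'.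
  suff [x0 le_x0] : exists2 x0, x0 <= x & all (fun v => x0 <= v) (w ++ w').
    by rewrite all_cat; exists x0.
  elim: (w ++ w') => [|v s [x0 le_x0 h]]; first by exists x.
  exists (Num.min x0 v); first by lia.
  rewrite /= ge_min lexx orbT /=; apply: sub_all h => z; lia.
pose P x := (forall t, t < x -> (countle w t <= countle w' t)%N) ->
  excess w x <= excess w' x.
suff: P x by apply.
apply: (@int_ind_above P x0) le_x0 => [_|t le_t IH h]; first by rewrite w0 w'0.
have le_t' : excess w t <= excess w' t by apply: IH => u lt_ut; apply: h; lia.
by rewrite !excessS; have := h t; lia.
Qed.

(** * Tails, height and slack: the functions phi and psi_j *)

Definition tail w j x : int := \sum_(v <- drop j w) (x - v).

(** This is phi, with [p] and [q] left free: it is used for [d] and [g], and also for the kept part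
    of [d] and the selected part of [c], because entries common to both arguments cancel. The same
    holds for [slack], which is psi_j. *)
Definition height (s : nat) p q x : int := s%:Z - (countle q x)%:Z + (countle p x)%:Z.

Definition slack a p q j x : int := tail a j x + excess p x - excess q x.

Lemma tail_sum w j x :
  tail w j x = x * (size w - j)%N%:Z - \sum_(v <- drop j w) v.
Proof.
rewrite /tail sumrB big_const_seq iter_addr_0 count_predT size_drop.
by rewrite -mulr_natr natz.
Qed.

Lemma tailS w j x : tail w j (x + 1) = tail w j x + (size w - j)%N%:Z.
Proof. by rewrite !tail_sum mulrDl mul1r addrAC. Qed.

Lemma slackS a p q j x : (j <= size a)%N ->
  slack a p q j (x + 1) = slack a p q j x + height (size a) p q x - j%:Z.
Proof. by move=> le_j; rewrite /slack tailS !excessS /height; lia. Qed.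

Lemma slack_noninc a p q j x y : (j <= size a)%N -> x <= y ->
  (forall t, x <= t -> height (size a) p q t <= j%:Z) ->
  slack a p q j y <= slack a p q j x.
Proof.
move=> le_j le_xy h; pose P t := slack a p q j t <= slack a p q j x.
apply: (@int_ind_above P x) le_xy => [|t le_t]; rewrite /P // slackS //.
by have := h t le_t; lia.
Qed.

(** [excess] sums the positive parts of [x - v] over all entries, [tail] the signed terms over a
    final segment only. *)
Lemma tail_le_excess w j x : tail w j x <= excess w x.
Proof.
rewrite -[in X in _ <= X](cat_take_drop j w) excess_cat /tail.
suff le_ex s : \sum_(v <- s) (x - v) <= excess s x.
  rewrite -[X in X <= _]add0r lerD //.
  by rewrite /excess sumr_ge0 // => v; lia.
elim: s => [|v s IH]; first by rewrite /excess !big_nil.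
have le_v : x - v <= (if v <= x then x - v else 0) by case: ifP; lia.
by rewrite excess_cons big_cons; apply: lerD.
Qed.

Lemma excess_eq_tail w j x :
  all (fun v => x <= v) (take j w) -> all (fun v => v <= x) (drop j w) ->
  excess w x = tail w j x.
Proof.
move=> ge_x /allP le_x; rewrite -[in LHS](cat_take_drop j w) excess_cat.
rewrite excess_none // add0r /excess /tail big_seq_cond [RHS]big_seq.
by apply: eq_bigl => v; case: (boolP (v \in _)) => // /le_x ->.
Qed.

Lemma partition_nth w (i j : nat) : is_partition w ->
  (i <= j)%N -> (j < size w)%N -> nthz w j <= nthz w i.
Proof.
move=> sw le_ij lt_j.
have tr : transitive (fun x y : int => y <= x) by move=> x y z; lia.
have re : reflexive (fun x y : int => y <= x) by move=> x; lia.
apply: (sorted_leq_nth tr re 0 sw) => //; rewrite inE //.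
exact: leq_ltn_trans lt_j.
Qed.

Lemma partition_head v w : is_partition (v :: w) -> all (fun y => y <= v) w.
Proof. by apply: order_path_min => x y z; lia. Qed.

(** The bridge between entries and counting functions: in a nonincreasing sequence the entries at
    most [x] form a final segment, whose length is [countle w x]. *)
Lemma partition_nth_le w (i : nat) x : is_partition w -> (i < size w)%N ->
  (nthz w i <= x) = (size w <= countle w x + i)%N.
Proof.
elim: w i => [//|v w IH] [|i] sw lt_i /=.
  rewrite addn0 /countle /=; case: (boolP (v <= x)) => [le_vx|nle].
    rewrite -[count _ _]/(countle w x) countle_all; first by lia.
    by apply/allP => y yw; have /allP/(_ y yw) := partition_head _ _ sw; lia.
  have := countle_leq_size w x; rewrite /countle; lia.
rewrite IH //; last exact: path_sorted sw.
rewrite /countle /= addnS ltnS.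
case: (boolP (v <= x)) => [le_vx|nle] //=.
rewrite -[count _ _]/(countle w x) countle_all; first by lia.
by apply/allP => y yw; have /allP/(_ y yw) := partition_head _ _ sw; lia.
Qed.

(** * Weak majorization in terms of thresholds *)

Lemma sum_drop w (r t : nat) : t = size w -> sumI w r.+1 t = \sum_(v <- drop r w) v.
Proof.
move=> ->; rewrite /sumI big_add1 /= /entry -[r in LHS]add0n big_addn -size_drop.
by rewrite [RHS](big_nth 0); apply: eq_bigr => i _; rewrite nth_drop addnC.
Qed.

Section Threshold.

Variables (m s : nat) (g d a : seq int).
Hypotheses (size_a : size a = s) (size_d : size d = m) (size_g : size g = (m + s)%N).
Hypotheses (part_d : is_partition d) (part_g : is_partition g).

(** Through [partition_nth_le], condition (1) becomes [countle d x <= countle g x] for all [x]; the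
    way back takes x = d_i. *)
Lemma height_le_size :
  (forall i, (1 <= i <= m)%N -> entry g (i + s) <= entry d i) <->
  (forall x, height s d g x <= s%:Z).
Proof.
clear a size_a; split=> h.
  move=> x; suff: (countle d x <= countle g x)%N by rewrite /height; lia.
  case def_r: (countle d x) => [//|r].
  have lt_rm : (r < m)%N by have := countle_leq_size d x; lia.
  have lt_m : (m - r.+1 < m)%N by lia.
  have := partition_nth_le _ _ x part_d (eq_ind_r (leq _) lt_m size_d).
  have lt_g : (m - r.+1 + s < size g)%N by lia.
  have := partition_nth_le _ _ x part_g lt_g.
  have := h (m - r.+1).+1; rewrite /entry addSn /=.
  lia.
move=> [//|i] /andP[_ lt_i]; rewrite /entry addSn /=.
set x : int := nthz d i.
have lt_g : (i + s < size g)%N by lia.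
have := partition_nth_le _ _ x part_d (eq_ind_r (leq _) lt_i size_d).
rewrite -/x lexx => /esym le_m; have := partition_nth_le _ _ x part_g lt_g.
move: (h x); rewrite /height; lia.
Qed.

(** The threshold is X = g_(h_j). Minimality of h_j says that phi stays below j from X on, and at X
    the excesses of [g] and [d] are the tails cut off in condition (2), so psi_j(X) is the
    difference of its two sides. *)
Lemma h_idx_threshold j : (1 <= j <= s)%N ->
  exists X : int, [/\ j%:Z <= height s d g (X - 1), forall t, X <= t -> height s d g t < j%:Z &
    (sumI d (h_idx g d j - j + 1) m + sumI a j.+1 s
       <= sumI g (h_idx g d j).+1 (m + s)) = (0 <= slack a d g j X)].
Proof.
move=> /andP[j_gt0 le_js]; rewrite /h_idx.
set p := (fun i : nat => _); set H1 := find _ _.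
have has_p : has p (iota 1 (size g)).
  (* At i = m + j the compared entry of [d] is d_(m+1) = -oo, so the search succeeds. *)
  apply/hasP; exists (m + j)%N; first by rewrite mem_iota; lia.
  rewrite /p /atE size_d size_g.
  by do 4 (try (case: ifP => ?; try by lia)).
have lt_H1 : (H1 < m + s)%N.
  by move: has_p; rewrite has_find size_iota -/H1 size_g.
have nth_io i : (i < m + s)%N -> nth 0%N (iota 1 (size g)) i = i.+1.
  by move=> lt_i; rewrite nth_iota ?size_g.
have pH : p H1.+1 by rewrite -nth_io //; exact: (nth_find 0%N has_p).
have npH i : (i < H1)%N -> p i.+1 = false.
  by move=> lt_i; rewrite -nth_io; [exact: (before_find 0%N lt_i) | lia].
have atg i : (i < m + s)%N -> atE g i.+1%:Z = Fin (nthz g i).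
  by move=> lt_i; rewrite /atE size_g !ifF //; lia.
have atd i : (i < m)%N -> atE d i.+1%:Z = Fin (nthz d i).
  by move=> lt_i; rewrite /atE size_d !ifF //; lia.
have le_jH : (j <= H1.+1)%N.
  (* For i < j the compared entry of [d] is +oo, so the search cannot stop there. *)
  rewrite leqNgt; apply/negP => lt_Hj; move: pH; rewrite /p {1}/atE.
  have -> : (H1.+1%:Z - j%:Z + 1 <= 0 :> int) by lia.
  by case: (atE g _).
pose X : int := nthz g H1.
have nthg i y : (i < m + s)%N -> (nthz g i <= y) = (m + s <= countle g y + i)%N.
  by move=> lt_i; rewrite partition_nth_le ?size_g.
have nthd i y : (i < m)%N -> (nthz d i <= y) = (m <= countle d y + i)%N.
  by move=> lt_i; rewrite partition_nth_le ?size_d.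
have ltX : (H1.+1 - j < m)%N -> nthz d (H1.+1 - j) < X.
  move=> lt_m; move: pH; rewrite /p atg //.
  have -> : H1.+1%:Z - j%:Z + 1 = (H1.+1 - j).+1 by lia.
  by rewrite atd.
have geX i : (i < H1)%N -> (j <= i.+1)%N ->
    (i.+1 - j < m)%N /\ nthz g i <= nthz d (i.+1 - j).
  move=> lt_iH le_ji; move: (npH _ lt_iH); rewrite /p atg; last by lia.
  have -> : i.+1%:Z - j%:Z + 1 = (i.+1 - j).+1 by lia.
  case: (ltnP (i.+1 - j) m) => [lt_im|le_im].
    by rewrite atd //= ltNge => /negbFE.
  rewrite /atE size_d /=.
  by have -> : (m%:Z < (i.+1 - j).+1%:Z :> int) by lia.
exists X; split.
- rewrite /height.
  have := nthg H1 (X - 1) lt_H1; rewrite -/X.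
  case: (ltnP (H1.+1 - j) m) => [lt_m|]; last by lia.
  by have := nthd _ (X - 1) lt_m; have := ltX lt_m; lia.
- move=> t le_Xt; rewrite ltNge; apply/negP; rewrite /height => le_jt.
  (* The last entry of [g] above [t] comes before position h_j, so by minimality the entry of [d]
     compared with it also exceeds [t]; this makes [countle d t] too small for j <= phi(t). *)
  have lt_i0 : (m + s - countle g t <= H1)%N.
    by have := nthg H1 t lt_H1; rewrite -/X le_Xt; lia.
  have := countle_leq_size g t; have := countle_leq_size d t; rewrite size_d size_g => le_d le_g.
  have [||lt_m] := geX (m + s - countle g t).-1; [lia|lia|].
  have := nthg (m + s - countle g t).-1 t; have := nthd _ t lt_m; lia.
- have -> : (H1.+1 - j + 1 = (H1.+1 - j).+1)%N by lia.
  rewrite !sum_drop // /slack.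
  have -> : excess g X = tail g H1.+1 X.
    apply: excess_eq_tail; apply/(all_nthP (0 : int)) => i lt_i.
      have lt_iH : (i < H1.+1)%N by move: lt_i; rewrite size_take_min; lia.
      by rewrite nth_take // partition_nth ?size_g.
    rewrite nth_drop partition_nth //; first by lia.
    by move: lt_i; rewrite size_drop; lia.
  have -> : excess d X = tail d (H1.+1 - j) X.
    apply: excess_eq_tail; apply/(all_nthP (0 : int)) => i lt_i; last first.
      move: lt_i; rewrite size_drop nth_drop => lt_i.
      have lt_m : (H1.+1 - j < m)%N by lia.
      by apply: le_trans (ltW (ltX lt_m)); rewrite partition_nth //; lia.
    have lt_iH : (i < H1.+1 - j)%N by move: lt_i; rewrite size_take_min; lia.
    rewrite nth_take //; have [||lt_m le_gd] := geX H1.-1; [lia|lia|].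
    apply: (@le_trans _ _ (nthz g H1.-1)); first by rewrite partition_nth ?size_g //; lia.
    by apply: le_trans le_gd _; rewrite partition_nth ?size_d //; lia.
  rewrite !tail_sum size_a size_d size_g.
  (* Both sides of (2) have equally many terms, so the multiples of X cancel; the truncated
     subtraction is exact because h_j - j <= m. *)
  have -> : (m + s - H1.+1)%N%:Z = (s - j)%N%:Z + (m - (H1.+1 - j))%N%:Z.
    case: (ltnP (H1.+1 - j) m) => [|le_m]; first by lia.
    suff : (H1.+1 - j <= m)%N by lia.
    case: (posnP H1) => [H0|H1_gt0]; first by lia.
    case: (ltnP j H1.+1) => [lt_jH|]; last by lia.
    by have [||lt_m _] := geX H1.-1; lia.
  have shift (A B C n1 n2 : int) : (A + B <= C) =
      (0 <= X * n1 - B + (X * n2 - A) - (X * (n1 + n2) - C)).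
    by apply/idP/idP; lia.
  exact: shift.
Qed.

End Threshold.

Lemma upper_bound w x : exists2 y, x <= y & all (fun v => v <= y) w.
Proof.
elim: w => [|v w [y le_xy le_wy]]; first by exists x.
exists (Num.max y v); first by rewrite le_max le_xy.
rewrite /= le_max lexx orbT; apply: sub_all le_wy => u le_uy.
by rewrite le_max le_uy.
Qed.

Section WeakMajor.

Variables (m s : nat) (g d a : seq int).
Hypotheses (size_a : size a = s) (size_d : size d = m) (size_g : size g = (m + s)%N).
Hypotheses (part_d : is_partition d) (part_g : is_partition g).

(** Above all entries nothing is truncated in [excess], so psi_0(y) is the difference of the two
    sides of (3). *)
Lemma total_slack y : all (fun v => v <= y) d -> all (fun v => v <= y) g ->
  (sumI d 1 m + sumI a 1 s <= sumI g 1 (m + s)) = (0 <= slack a d g 0 y).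
Proof.
move=> le_d le_g; rewrite !sum_drop // /slack.
rewrite (excess_eq_tail d 0) ?take0 ?drop0 // (excess_eq_tail g 0) ?take0 ?drop0 //.
rewrite !tail_sum !drop0 !subn0 size_a size_d size_g PoszD.
have shift (A B C n1 n2 : int) : (A + B <= C) =
    (0 <= y * n1 - B + (y * n2 - A) - (y * (n2 + n1) - C)).
  by apply/idP/idP; lia.
exact: shift.
Qed.

Lemma weak_major_height x : weak_major g d a -> height s d g x <= s%:Z.
Proof.
rewrite /weak_major size_a size_d => -[_ le_gd _ _].
by apply: (height_le_size _ _ _ _ size_d size_g part_d part_g).1 le_gd _.
Qed.

(** Descend from j = s, keeping phi <= j on [x, oo). If x <= X_j, then psi_j does not increase from
    x to X_j, so psi_j(x) >= psi_j(X_j) >= 0. Otherwise phi < j on [x, oo) and j can be lowered; at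
    j = 0 condition (3) takes over. *)
Lemma weak_major_slack x : weak_major g d a ->
  exists r : nat, [/\ (r <= s)%N, height s d g x <= r%:Z & 0 <= slack a d g r x].
Proof.
move=> maj; have := maj; rewrite /weak_major size_a size_d => -[_ _ tails total].
suff P j : (j <= s)%N -> (forall t, x <= t -> height s d g t <= j%:Z) ->
  exists r : nat, [/\ (r <= s)%N, height s d g x <= r%:Z & 0 <= slack a d g r x].
  by apply: (P s) => // t _; apply: weak_major_height.
elim: j => [_|j IH lt_js] le_h.
  have [y le_xy] := upper_bound (d ++ g) x; rewrite all_cat => /andP[le_d le_g].
  exists 0%N; split=> //; first exact: le_h.
  move: total; rewrite (total_slack y) // => /le_trans; apply.
  by apply: slack_noninc; rewrite ?size_a.
have le_j : (1 <= j.+1 <= s)%N by [].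
have [X [_ ltX eqX]] := h_idx_threshold _ _ _ _ _ size_a size_d size_g part_d part_g _ le_j.
have [le_xX|lt_Xx] := lerP x X.
  exists j.+1; split=> //; first exact: le_h.
  have := tails _ le_j; rewrite eqX => /le_trans; apply.
  by apply: slack_noninc; rewrite ?size_a.
by apply: IH => [|t le_xt]; [exact: ltnW | have := ltX t; lia].
Qed.

Lemma weak_major_intro y :
  (forall x, height s d g x <= s%:Z) ->
  (forall (j : nat) X, (1 <= j <= s)%N -> j%:Z <= height s d g (X - 1) ->
     (forall t, X <= t -> height s d g t < j%:Z) -> 0 <= slack a d g j X) ->
  all (fun v => v <= y) d -> all (fun v => v <= y) g -> 0 <= slack a d g 0 y ->
  weak_major g d a.
Proof.
move=> le_h tails le_d le_g; rewrite -total_slack // => total.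
rewrite /weak_major size_a size_d; split=> //.
  by apply/(height_le_size _ _ _ _ size_d size_g part_d part_g).
move=> j le_j.
have [X [geX ltX ->]] := h_idx_threshold _ _ _ _ _ size_a size_d size_g part_d part_g _ le_j.
exact: tails.
Qed.

End WeakMajor.

(** * Greedy tails *)

Lemma countle_notin w x : x \notin w -> countle w x = countle w (x - 1).
Proof.
move=> /negP xNw; apply: eq_in_count => v vw.
case: (eqVneq v x) => [vx|ne]; first by case: xNw; rewrite -vx.
lia.
Qed.

Lemma partition_drop_le w (j : nat) x : is_partition w ->
  (size w <= j + countle w x)%N -> all (fun v => v <= x) (drop j w).
Proof.
move=> part_w le_sz; apply/(all_nthP (0 : int)) => i; rewrite size_drop nth_drop => lt_i.
by rewrite partition_nth_le //; lia.
Qed.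

Lemma tail_homo w (q r : nat) x : (q <= r)%N ->
  all (fun v => v <= x) (drop q w) -> tail w r x <= tail w q x.
Proof.
move=> le_qr; rewrite /tail -(subnK le_qr) -drop_drop.
move: (drop q w) (r - q)%N => u i /allP le_x.
rewrite -[X in _ <= \sum_(_ <- X) _](cat_take_drop i u) big_cat /= lerDr.
by rewrite big_seq_cond sumr_ge0 // => v /andP[/mem_take /le_x]; lia.
Qed.

(* [p] and [r] collect the entries of [d] outside and inside [Delta], and [q]
   those of [c] inside [S]. *)
Record greedy (a p r q : seq int) : Prop := Greedy {
  greedy_height : forall x, height (size a) p q x <= (size a)%:Z;
  greedy_keep : forall (j : nat) x, (0 < j)%N ->
    height (size a) p q (x - 1) < j%:Z <= height (size a) p q x ->
    (j + countle a (x - 1) <= size a)%N \/ 0 <= slack a p q j x;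
  greedy_drop : forall x, x \in r -> exists j : nat,
    [/\ j%:Z <= height (size a) p q x + 1, (size a < j + countle a (x - 1))%N &
        (j <= size a)%N -> slack a p q j x < 0]
}.

(** If the count of [q ++ r] exceeded that of [g] at [x], then phi for (d, g) would be at least phi
    for (p, q) plus 1, hence i <= j for the index i of [greedy_drop]. Since a_i < x, lowering j to i
    can only raise the tail of [a], and the excess of [q ++ r] is still bounded by that of [g]; so
    psi_j >= 0 for (d, g) would contradict psi_i < 0 for (p, q). *)
Lemma greedy_drop_le a p r q d g x :
  is_partition a -> greedy a p r q -> perm_eq d (r ++ p) ->
  height (size a) d g x <= (size a)%:Z ->
  (exists j : nat, [/\ (j <= size a)%N, height (size a) d g x <= j%:Z
                     & 0 <= slack a d g j x]) ->
  (forall t, t < x -> (countle (q ++ r) t <= countle g t)%N) ->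
  x \in r -> (countle (q ++ r) x <= countle g x)%N.
Proof.
move=> part_a [_ _ drop_rule] perm_d le_s [j [le_js le_hj slack_j]] IH xr.
have [i [le_i lt_i lt0]] := drop_rule x xr.
rewrite leqNgt; apply/negP => lt_g; move: le_hj le_i; rewrite /height.
rewrite (countle_perm _ _ x perm_d); move: lt_g; rewrite !countle_cat => lt_g le_hj le_i.
have le_ij : (i <= j)%N by lia.
have le_is : (i <= size a)%N by lia.
have := lt0 le_is; move: slack_j; rewrite /slack (excess_perm _ _ x perm_d) excess_cat.
have : tail a j x <= tail a i x.
  apply: tail_homo => //; apply: partition_drop_le => //.
  by have := countle_homo a (x - 1) x; lia.
have := excess_le _ _ _ IH; rewrite excess_cat; lia.
Qed.

(** Induction upwards on [x]: the left count rises only at entries of [r] or [r'], and there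
    [greedy_drop_le] applies to (d, a) or, dually, to (c, b). *)
Lemma greedy_le a b p p' r r' c d g :
  is_partition a -> is_partition b ->
  greedy a p r r' -> greedy b p' r' r -> perm_eq d (r ++ p) -> perm_eq c (r' ++ p') ->
  (forall x, height (size a) d g x <= (size a)%:Z) ->
  (forall x, exists j : nat, [/\ (j <= size a)%N, height (size a) d g x <= j%:Z
                     & 0 <= slack a d g j x]) ->
  (forall x, height (size b) c g x <= (size b)%:Z) ->
  (forall x, exists j : nat, [/\ (j <= size b)%N, height (size b) c g x <= j%:Z
                     & 0 <= slack b c g j x]) ->
  forall x, (countle (r' ++ r) x <= countle g x)%N.
Proof.
move=> part_a part_b gr_a gr_b perm_d perm_c h_d V_d h_c V_c x.
have [y le_xy low] : exists2 y, y <= x & forall t, t <= y -> countle (r' ++ r) t = 0%N.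
  have [y le_xy ub] := upper_bound (map -%R (r' ++ r)) (- x).
  exists (- y - 1) => [|t le_t]; first by lia.
  by apply: countle_none; move: ub; rewrite all_map; apply: sub_all => v /=; lia.
pose P x := forall t, t <= x -> (countle (r' ++ r) t <= countle g t)%N.
suff: P x by apply.
apply: (@int_ind_above P y) le_xy => [t /low -> //|u _ IH t le_t].
have [le_tu|lt_ut] := lerP t u; first exact: IH.
have IH' v : v < t -> (countle (r' ++ r) v <= countle g v)%N.
  by move=> lt_v; apply: IH; lia.
case: (boolP (t \in r)) => [tr|tNr].
  exact: (greedy_drop_le a p r r' d g t part_a gr_a perm_d (h_d t) (V_d t) IH' tr).
case: (boolP (t \in r')) => [tr'|tNr'].
  have eq_rr' u' : countle (r ++ r') u' = countle (r' ++ r) u'.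
    by apply: countle_perm; rewrite perm_catC.
  rewrite -eq_rr'; apply: (greedy_drop_le b p' r' r c g t) => // v /IH'.
  by rewrite eq_rr'.
have -> : countle (r' ++ r) t = countle (r' ++ r) (t - 1).
  by apply: countle_notin; rewrite mem_cat negb_or tNr'.
apply: leq_trans (countle_homo _ (t - 1) t _); last by lia.
by apply: IH'; lia.
Qed.

(** The excess of [r] occurs in that of [d] and, as a lower bound, in that of [g]; it cancels. *)
Lemma slack_excess a d p q r g (j : nat) x : perm_eq d (r ++ p) ->
  (forall t, t < x -> (countle (q ++ r) t <= countle g t)%N) ->
  0 <= slack a d g j x -> excess q x <= excess a x + excess p x.
Proof.
move=> perm_d le_g; rewrite /slack (excess_perm _ _ x perm_d) excess_cat.
have := excess_le _ _ _ le_g; rewrite excess_cat.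
by have := tail_le_excess a j x; lia.
Qed.

Lemma slack_nth a p q (j : nat) : is_partition a -> (0 < j <= size a)%N ->
  let x := nthz a j.-1 in slack a p q j x = excess a x + excess p x - excess q x.
Proof.
move=> part_a /andP[j_gt0 le_j] x; rewrite /slack -(excess_eq_tail a j) //;
  apply/(all_nthP (0 : int)) => i.
  by rewrite size_take_min => lt_i; rewrite nth_take ?partition_nth //; lia.
by rewrite size_drop nth_drop => lt_i; rewrite partition_nth //; lia.
Qed.

(** At a_j, psi_j is the difference of the dominating and dominated excess, hence nonnegative. From
    there on psi_j does not decrease while phi >= j, and whenever phi climbs back to j the rule
    [greedy_keep] restores psi_j >= 0; its first alternative, a_j >= t, leaves only t = a_j. *)
Lemma greedy_slack_ge0 a p r q (j : nat) x :
  is_partition a -> greedy a p r q ->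
  (forall u, excess q u <= excess a u + excess p u) ->
  (0 < j <= size a)%N -> nthz a j.-1 <= x -> j%:Z <= height (size a) p q (x - 1) ->
  0 <= slack a p q j x.
Proof.
move=> part_a [_ keep_rule _] dom le_j le_x.
have at_nth : 0 <= slack a p q j (nthz a j.-1).
  by rewrite slack_nth //; have := dom (nthz a j.-1); lia.
pose P x := j%:Z <= height (size a) p q (x - 1) -> 0 <= slack a p q j x.
suff: P x by apply.
apply: (@int_ind_above P (nthz a j.-1)) le_x => [//|t le_t IH].
rewrite /P addrK slackS; last by lia.
move=> le_h; have [le_h'|lt_h'] := lerP j%:Z (height (size a) p q (t - 1)).
  by have := IH le_h'; lia.
have [||le_at|] := keep_rule j t; [lia|by rewrite lt_h'| |lia].
have eq_t : nthz a j.-1 = t.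
  by have := partition_nth_le a j.-1 (t - 1) part_a; lia.
by move: at_nth; rewrite eq_t; lia.
Qed.

(** * Completion of a dominated tail to an admissible g *)

Lemma excess_large w x : all (fun v => v <= x) w ->
  excess w x = x * (size w)%:Z - \sum_(v <- w) v.
Proof.
by move=> le_w; rewrite (excess_eq_tail w 0) ?take0 ?drop0 // tail_sum drop0 subn0.
Qed.

(* Compare the slopes of both sides at large arguments. *)
Lemma excess_le_size a p q :
  (forall u, excess q u <= excess a u + excess p u) ->
  (size q <= size a + size p)%N.
Proof.
move=> dom; rewrite leqNgt; apply/negP => lt_q.
pose C : int := \sum_(v <- q) v - \sum_(v <- a) v - \sum_(v <- p) v.
have [y le_C] := upper_bound (q ++ a ++ p) (`|C| + 1).
rewrite !all_cat => /and3P[/excess_large eq_q /excess_large eq_a /excess_large eq_p].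
have := dom y; rewrite eq_q eq_a eq_p.
have : C + y * ((size a)%:Z + (size p)%:Z) < y * (size q)%:Z.
  suff : y * 1 <= y * ((size q)%:Z - ((size a)%:Z + (size p)%:Z)) by lia.
  by apply: ler_wpM2l; lia.
rewrite /C; move: (\sum_(v <- q) v) (\sum_(v <- a) v) (\sum_(v <- p) v).
by move=> A B D; lia.
Qed.

(** Below [x] the padding is invisible and [r] cancels, so phi and psi_j for (d, g) are those for
    (p, q); from [x] on phi is 0. Thus every threshold X_j with j >= 1 is at most [x], and two cases
    remain according to the position of a_j. *)
Lemma greedy_weak_major a d p q r g (n : nat) x :
  is_partition a -> is_partition d -> is_partition g -> greedy a p r q ->
  (forall u, excess q u <= excess a u + excess p u) ->
  perm_eq d (r ++ p) -> perm_eq g (q ++ r ++ nseq n x) ->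
  (n + size q = size a + size p)%N ->
  all (fun v => v <= x) a -> all (fun v => v <= x) d -> all (fun v => v <= x) q ->
  weak_major g d a.
Proof.
move=> part_a part_d part_g gr dom perm_d perm_g eq_n le_a le_d le_q.
have size_d : (size d = size r + size p)%N by rewrite (perm_size perm_d) size_cat.
have size_g : (size g = size d + size a)%N.
  by rewrite (perm_size perm_g) !size_cat size_nseq /=; lia.
have le_g : all (fun v => v <= x) g.
  rewrite (perm_all _ perm_g) !all_cat le_q all_nseq lexx orbT andbT.
  by move: le_d; rewrite (perm_all _ perm_d) all_cat => /andP[].
have h_large t : x <= t -> height (size a) d g t = 0.
  move=> le_xt; rewrite /height !countle_all ?size_g; first by lia.
    by apply: sub_all le_d => v; lia.
  by apply: sub_all le_g => v; lia.
have h_small t : t < x -> height (size a) d g t = height (size a) p q t.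
  move=> lt_tx; rewrite /height (countle_perm _ _ _ perm_d) (countle_perm _ _ _ perm_g).
  rewrite !countle_cat (countle_none (nseq n x)); first by lia.
  by rewrite all_nseq lt_tx orbT.
have slack_small j t : t <= x -> slack a d g j t = slack a p q j t.
  move=> le_tx; rewrite /slack (excess_perm _ _ _ perm_d) (excess_perm _ _ _ perm_g).
  rewrite !excess_cat (excess_none (nseq n x)); first by lia.
  by rewrite all_nseq le_tx orbT.
apply: (weak_major_intro (size d) (size a) g d a _ _ _ _ _ x) => //.
- move=> t; have [/h_large -> //|/h_small ->] := lerP x t.
  exact: greedy_height gr t.
- move=> j t le_j le_h ltj.
  have lt_tx : t - 1 < x.
    by rewrite ltNge; apply/negP => /h_large; lia.
  rewrite h_small // in le_h; have le_tx : t <= x by lia.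
  have [le_at|lt_ta] := lerP (nthz a j.-1) t.
    by rewrite slack_small //; apply: greedy_slack_ge0 gr dom le_j le_at le_h.
  (* When X_j < a_j, psi_j does not increase from X_j to a_j, and its value at a_j is nonnegative by
     domination. *)
  apply: le_trans (slack_noninc a d g j t (nthz a j.-1) _ (ltW lt_ta) _); first last.
  - by move=> u /ltj; lia.
  - by lia.
  rewrite slack_small; last by apply: (all_nthP (0 : int) le_a); lia.
  by rewrite slack_nth //; have := dom (nthz a j.-1); lia.
- rewrite slack_small // /slack -(excess_eq_tail a 0) ?take0 ?drop0 //.
  by have := dom x; lia.
Qed.

Lemma greedy_exists a b c d p p' r r' :
  is_partition a -> is_partition b -> is_partition c -> is_partition d ->
  (size d + size a = size c + size b)%N ->
  greedy a p r r' -> greedy b p' r' r -> perm_eq d (r ++ p) -> perm_eq c (r' ++ p') ->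
  (forall u, excess r' u <= excess a u + excess p u) ->
  (forall u, excess r u <= excess b u + excess p' u) ->
  exists g, is_partition g /\ weak_major g d a /\ weak_major g c b.
Proof.
move=> part_a part_b part_c part_d eq_sz gr_a gr_b perm_d perm_c dom_a dom_b.
have size_d : (size d = size r + size p)%N by rewrite (perm_size perm_d) size_cat.
have size_c : (size c = size r' + size p')%N by rewrite (perm_size perm_c) size_cat.
have := excess_le_size _ _ _ dom_a => le_sz.
have [x _] := upper_bound (a ++ b ++ c ++ d) 0.
rewrite !all_cat => /and4P[le_a le_b le_c le_d].
(* The padding brings [g] to its full length; by [eq_sz] the same [n] equals
   [size b + size p' - size r], so one [g] serves both pairs. *)
pose n := (size a + size p - size r')%N.
pose g := sort (fun x y : int => y <= x) (r' ++ r ++ nseq n x).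
have part_g : is_partition g by apply: sort_sorted => y z; lia.
have perm_g : perm_eq g (r' ++ r ++ nseq n x) by rewrite perm_sort.
have le_r : all (fun v => v <= x) r.
  by move: le_d; rewrite (perm_all _ perm_d) all_cat => /andP[].
have le_r' : all (fun v => v <= x) r'.
  by move: le_c; rewrite (perm_all _ perm_c) all_cat => /andP[].
exists g; split=> //; split.
  apply: greedy_weak_major perm_d perm_g _ _ _ _ => //.
  by rewrite /n; lia.
apply: (greedy_weak_major b c p' r r' g n x) => //; last by rewrite /n; lia.
by rewrite (perm_trans perm_g) // perm_catCA.
Qed.

(** * Conditions (i) and (ii) *)

Definition sel w (P : pred nat) : seq int := [seq entry w i | i <- iota 1 (size w) & P i].

Lemma map_entry w : [seq entry w i | i <- iota 1 (size w)] = w.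
Proof.
apply: (@eq_from_nth _ (0 : int)); rewrite size_map size_iota // => i lt_i.
by rewrite (nth_map 0%N) ?size_iota // nth_iota.
Qed.

Lemma sel_perm w (P : pred nat) : perm_eq w (sel w P ++ sel w (predC P)).
Proof.
by rewrite -[in X in perm_eq X _](map_entry w) -map_cat perm_map // perm_sym perm_filterC.
Qed.

Lemma sel_partition w (P : pred nat) : is_partition w -> is_partition (sel w P).
Proof.
apply: subseq_sorted; first by move=> x y z; lia.
by rewrite -[X in subseq _ X](map_entry w); apply: map_subseq; apply: filter_subseq.
Qed.

Lemma count_sel w (P : pred nat) (f : pred int) :
  count f (sel w P) = cnt (size w) (fun i => P i && f (entry w i)).
Proof.
rewrite /sel count_map count_filter; apply: eq_count => i /=; exact: andbC.
Qed.

Lemma sum_sel w (P : pred nat) (f : pred int) :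
  \sum_(v <- sel w P | f v) v = sumP w (fun i => P i && f (entry w i)).
Proof.
rewrite /sel big_map big_filter_cond; exact: eq_bigl.
Qed.

Lemma entry_le_index w (i : nat) x : is_partition w -> i \in iota 1 (size w) ->
  (count (fun v => (x < v)%R) w < i)%N = (entry w i <= x).
Proof.
rewrite mem_iota /entry => part_w /andP[i_gt0 lt_i].
rewrite partition_nth_le //; last by lia.
by have := countle_gt w x; lia.
Qed.

Lemma sum_drop_le w x : is_partition w ->
  \sum_(v <- drop (size w - countle w x) w) v = \sum_(v <- w | v <= x) v.
Proof.
move=> part_w; set n := (size w - countle w x)%N.
have take0 : \sum_(v <- take n w | v <= x) v = 0.
  rewrite big_seq_cond big1 // => v /andP[/(nthP (0 : int))[i]].
  rewrite size_take_min => lt_i <-.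
  by rewrite nth_take ?partition_nth_le //; have := countle_leq_size w x; lia.
rewrite -[in RHS](cat_take_drop n w) big_cat /= take0.
rewrite add0r big_seq_cond [RHS]big_seq_cond; apply: eq_bigl => v; rewrite andbT.
case: (boolP (v \in _)) => //= /(nthP (0 : int))[i]; rewrite size_drop nth_drop => lt_i <-.
have {}lt_i : (i < size w - (size w - countle w x))%N := lt_i.
by rewrite partition_nth_le // /n; [apply/esym|]; lia.
Qed.

Lemma excess_countle w x : is_partition w ->
  excess w (x + 1) = tail w (size w - countle w x) (x + 1).
Proof.
move=> part_w; apply: excess_eq_tail; apply/(all_nthP (0 : int)) => i.
  rewrite size_take_min => lt_i; rewrite nth_take; last by lia.
  by have := partition_nth_le w i x part_w; lia.
rewrite size_drop nth_drop => lt_i.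
by have := partition_nth_le w (size w - countle w x + i) x part_w; lia.
Qed.

Lemma ecmp_total : total ecmp.
Proof. by move=> [x [b i]] [y [b' j]]; rewrite /ecmp /=; case: b b' => -[]; lia. Qed.

Lemma ecmp_trans : transitive ecmp.
Proof.
move=> [x [b i]] [y [b' j]] [z [b'' k]]; rewrite /ecmp /=.
by case: b b' b'' => -[] -[] /=; lia.
Qed.

Lemma evals_partition w w' : is_partition (evals w w').
Proof.
rewrite /is_partition /evals sorted_map.
apply: sub_sorted (sort_sorted ecmp_total _) => -[x [b i]] [y [b' j]].
by rewrite /ecmp /=; lia.
Qed.

Lemma evals_perm w w' : perm_eq (evals w w') (w ++ w').
Proof.
rewrite /evals /etag; set l := (l in sort _ l).
have sort_l : perm_eq (sort ecmp l) l by rewrite perm_sort.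
apply: perm_trans (perm_map fst sort_l) _.
by rewrite map_cat -!map_comp /comp /= !map_entry.
Qed.

Lemma sumI_drop w (i j : nat) : (i <= j <= size w)%N ->
  sumI w i.+1 j = \sum_(v <- drop i w) v - \sum_(v <- drop j w) v.
Proof.
move=> /andP[le_ij le_j]; rewrite -(sum_drop w i (size w)) // -(sum_drop w j (size w)) // /sumI.
rewrite (big_cat_nat (n := j.+1) (p := (size w).+1)) //=.
by rewrite addrK.
Qed.

(** The sum starts at the n-th smallest entry. For n > size w its lower index is at most 0, the sum
    is +oo and the inequality fails; hence the conjunct [n <= size w]. *)
Lemma leE_sumE w (n k : nat) i z : i = (size w)%:Z - n%:Z + 1 -> i <= k%:Z ->
  (k <= size w)%N ->
  leE (sumE w i k%:Z) (Fin z) = (n <= size w)%N &&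
    (\sum_(v <- drop (size w - n) w) v - \sum_(v <- drop k w) v <= z).
Proof.
move=> def_i le_ik le_k; rewrite /sumE ltNge le_ik /=.
have [le_n|lt_n] := leqP n (size w); last by rewrite ifT //; lia.
rewrite ifF; last by lia.
rewrite ifF; last by lia.
have -> : absz i = (size w - n).+1 by lia.
by rewrite /= sumI_drop //; lia.
Qed.

(* Comparing the sums of the smallest entries of [e] and of the union of [q]
   and [r] at the entries of [q] suffices, since by [greedy_drop] the union has
   no other entries where the comparison could start to fail. *)
Lemma greedy_dominates a p r q e : greedy a p r q ->
  is_partition q -> is_partition r -> is_partition e -> perm_eq e (a ++ r ++ p) ->
  (forall y : nat, (1 <= y <= size q)%N ->
    let x := nthz q y.-1 in
    let n := (size q - y + 1 + countle r x)%N in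
    (countle a x + countle p x < size q - y + 1)%N ->
    (n <= size e)%N /\
    \sum_(v <- drop (size e - n) e) v
      <= \sum_(v <- drop y.-1 q) v + \sum_(v <- drop (size r - countle r x) r) v) <->
  (forall u, excess q u <= excess a u + excess p u).
Proof.
move=> gr part_q part_r part_e perm_e.
have size_e : size e = (size a + (size r + size p))%N.
  by rewrite (perm_size perm_e) !size_cat.
split=> [le_e|dom].
  move=> u.
  have [x0 le_x0 /excess_none low] : exists2 x0, x0 <= u & all (fun v => x0 <= v) q.
    have [y le_y ub] := upper_bound (map -%R q) (- u).
    exists (- y); first by lia.
    by move: ub; rewrite all_map; apply: sub_all => v /=; lia.
  have ge0 w x : 0 <= excess w x by rewrite /excess sumr_ge0 // => v; lia.
  pose P u := excess q u <= excess a u + excess p u.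
  rewrite -/(P u).
  apply: (@int_ind_above P x0) le_x0 => [|t _ IH].
    by rewrite /P low addr_ge0.
  rewrite /P leNgt; apply/negP => lt_t.
  have lt_q : (countle a t + countle p t < countle q t)%N.
    by move: IH lt_t; rewrite /P !excessS; lia.
  have le_q := countle_leq_size q t.
  (* Domination would first fail between [t] and [t + 1]; test the hypothesis at the largest entry
     [x] of [q] that is at most [t]. *)
  pose y := (size q - countle q t).+1.
  have le_y : (1 <= y <= size q)%N by rewrite /y; lia.
  pose x : int := nthz q y.-1.
  have le_xt : x <= t by rewrite /x partition_nth_le // /y; lia.
  have q_x : countle q x = countle q t.
    apply/eqP; rewrite eqn_leq countle_homo //=.
    have := partition_nth_le q y.-1 x part_q; rewrite lexx /y /=; lia.
  (* An entry v of [r] with x < v <= t would, by [greedy_drop], satisfy [countle q v <= countle a (v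
     - 1) + countle p v], against [lt_q]. *)
  have r_x : countle r x = countle r t.
    apply: eq_in_count => /= v vr; apply/idP/idP => [|le_vt]; first by lia.
    rewrite leNgt; apply/negP => lt_xv.
    have [j [le_j lt_j _]] := greedy_drop _ _ _ _ gr v vr.
    move: le_j; rewrite /height.
    have := countle_homo a (v - 1) t; have := countle_homo p v t.
    have := countle_homo q x v; lia.
  have := le_e y le_y; cbv zeta; rewrite -/x r_x.
  have -> : (size q - y + 1 = countle q t)%N by rewrite /y; lia.
  case; first by have := countle_homo a x t; have := countle_homo p x t; lia.
  move=> le_n le_sum.
  (* At [t + 1] the tail of the n smallest entries of [e] bounds its excess from below, and by
     [le_sum] it is at least the excess of [q] plus that of [r]. *)
  have := tail_le_excess e (size e - (countle q t + countle r t)) (t + 1).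
  rewrite (excess_perm _ _ _ perm_e) !excess_cat.
  have := excess_countle q t part_q; have := excess_countle r t part_r.
  move: lt_t le_sum; rewrite !tail_sum /y /=.
  move: (\sum_(v <- drop _ e) v) (\sum_(v <- drop _ q) v) (\sum_(v <- drop _ r) v).
  move=> s1 s2 s3.
  have := countle_leq_size r t.
  have -> : (size e - (size e - (countle q t + countle r t)))%N = (countle q t + countle r t)%N by lia.
  have -> : (size q - (size q - countle q t))%N = countle q t by lia.
  move=> le_r; have -> : (size r - (size r - countle r t))%N = countle r t by lia.
  rewrite PoszD mulrDr; lia.
move=> y le_y x n lt_n.
have le_sz := excess_le_size _ _ _ dom.
have le_r := countle_leq_size r x.
have le_n : (n <= size e)%N by rewrite /n size_e; lia.
split=> //.
(* At the n-th smallest entry of [e], the excess of [e] is exactly the tail of its n smallest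
   entries; the tails of [q] and [r] have n terms together, so the multiples of [u] cancel. *)
pose u : int := nthz e (size e - n).
have lt_xu : x < u.
  rewrite ltNge; apply/negP; rewrite /u partition_nth_le; last by rewrite /n; lia.
    rewrite (countle_perm _ _ _ perm_e) !countle_cat /n.
    by have := countle_leq_size a x; have := countle_leq_size p x; lia.
  exact: part_e.
have := dom u.
have := tail_le_excess q y.-1 u; have := tail_le_excess r (size r - countle r x) u.
have : excess e u = tail e (size e - n) u.
  apply: excess_eq_tail; apply/(all_nthP (0 : int)) => i.
    rewrite size_take_min => lt_i; rewrite nth_take; last by lia.
    by rewrite partition_nth //; lia.
  rewrite size_drop nth_drop => lt_i.
  by rewrite partition_nth //; lia.
rewrite (excess_perm _ _ _ perm_e) !excess_cat !tail_sum.
move: (\sum_(v <- drop _ e) v) (\sum_(v <- drop _ q) v) (\sum_(v <- drop _ r) v).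
move=> s1 s2 s3.
have -> : (size e - (size e - n))%N = n by lia.
have -> : (size q - y.-1)%N = (size q - y + 1)%N by lia.
have -> : (size r - (size r - countle r x))%N = countle r x by lia.
rewrite /n PoszD mulrDr; lia.
Qed.

Section Conditions.

Variables (a c d : seq int) (S D : seq nat).
Hypotheses (part_a : is_partition a) (part_c : is_partition c) (part_d : is_partition d).
Hypothesis S_sub : S = [seq i <- iota 1 (size c) | i \in S].

Let e := evals a d.
Let q := sel c (mem S).
Let r := sel d (mem D).
Let p := sel d (predC (mem D)).

Hypothesis disjoint_cd : forall v, v \in c -> v \notin d.

Let perm_d : perm_eq d (r ++ p).
Proof. exact: sel_perm. Qed.

Let perm_e : perm_eq e (a ++ r ++ p).
Proof. by apply: perm_trans (evals_perm a d) _; rewrite perm_cat2l. Qed.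

Let part_q : is_partition q := sel_partition c _ part_c.
Let part_r : is_partition r := sel_partition d _ part_d.

Let size_e : size e = (size a + (size r + size p))%N.
Proof. by rewrite (perm_size perm_e) !size_cat. Qed.

Let size_q : size q = size S.
Proof. by rewrite /q /sel size_map {2}S_sub. Qed.

(* The condition at [x = c^y] compares the smallest entries of [e] with the
   equally many smallest entries of the union of [c_i, i \in S] and
   [d_i, i \in Delta], namely those up to [c^y]. *)
Lemma condE :
  cond c S d D a e <-> forall y : nat, (1 <= y <= size q)%N ->
    let x := nthz q y.-1 in
    let n := (size q - y + 1 + countle r x)%N in
    (countle a x + countle p x < size q - y + 1)%N ->
    (n <= size e)%N /\
    \sum_(v <- drop (size e - n) e) v
      <= \sum_(v <- drop y.-1 q) v + \sum_(v <- drop (size r - countle r x) r) v.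
Proof.
have q_S : q = map (entry c) S by rewrite /q /sel {2}S_sub.
rewrite /cond -size_q.
suff main (y : nat) : (1 <= y <= size q)%N -> let x : int := nthz q y.-1 in
    let n := (size q - y + 1 + countle r x)%N in
    let my := count (fun z => x < z) a in
    let zy := count (fun z => x < z) d in
    let ty : int := (size a)%:Z - (size q - y)%:Z
      + (cnt (size d) (fun i => (i \notin D) && (entry d i < x)))%:Z in
    (ty <= my%:Z) = (countle a x + countle p x < size q - y + 1)%N /\
    (ty <= my%:Z ->
    leE (sumE e (zy%:Z + ty) (zy + my)%:Z)
        (Fin (\sum_(y <= i < (size q).+1) entry c (nth 0%N S i.-1)
              - sumP d (fun i => (zy < i)%N && (i \notin D))
              - sumI a my.+1 (size a)))
    = (n <= size e)%N && (\sum_(v <- drop (size e - n) e) v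
      <= \sum_(v <- drop y.-1 q) v + \sum_(v <- drop (size r - countle r x) r) v)).
  have eq_x (y : nat) : (1 <= y <= size q)%N -> nthz q y.-1 = entry c (nth 0%N S y.-1).
    by move=> le_y; rewrite q_S (nth_map 0%N) -?size_q //; lia.
  split=> h y le_y; have := main y le_y; rewrite /= eq_x // => -[eq_t eq_c].
    move=> lt_n; apply/andP; rewrite -eq_c ?eq_t //.
    by apply: (h y le_y); rewrite eq_t.
  by move=> le_t; rewrite eq_c //; apply/andP; move: (h y le_y); rewrite /= eq_x // -eq_t; apply.
move=> le_y x n my zy.
have xc : x \in c.
  have lt_y : (y.-1 < size q)%N by lia.
  have : x \in q by rewrite mem_nth.
  by rewrite (perm_mem (sel_perm c (mem S))) mem_cat => ->.
have size_d : size d = (size r + size p)%N by rewrite (perm_size perm_d) size_cat.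
have xNd : x \notin d := disjoint_cd x xc.
(* As [x] is an entry of [c], the strict count in t_y agrees with [countle p x]. *)
have xNp : x \notin p.
  by apply: contra xNd; rewrite (perm_mem perm_d) mem_cat => ->; rewrite orbT.
have -> : cnt (size d) (fun i => (i \notin D) && (entry d i < x)) = countle p x.
  rewrite (countle_notin _ _ xNp).
  rewrite -(count_sel d (predC (mem D)) (fun v => v < x)).
  by apply: eq_count => v; clear; lia.
move=> ty; have a_x : (countle a x + my = size a)%N := countle_gt a x.
have d_x : (countle d x + zy = size d)%N := countle_gt d x.
have zy_lt i : i \in iota 1 (size d) -> (zy < i)%N = (entry d i <= x).
  exact: entry_le_index.
clearbody my zy.
have e_x : (countle e x + (zy + my) = size e)%N.
  rewrite (countle_perm _ _ x perm_e) size_e !countle_cat.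
  have := countle_perm _ _ x perm_d; rewrite countle_cat.
  by clear -a_x d_x size_d; lia.
have part_e : is_partition e := evals_partition a d.
split; first by rewrite /ty; clear -a_x le_y; apply/idP/idP; lia.
move=> le_t.
have -> : \sum_(y <= i < (size q).+1) entry c (nth 0%N S i.-1) = \sum_(v <- drop y.-1 q) v.
  rewrite -(sum_drop q y.-1 (size q)) // /sumI prednK; last by case/andP: le_y.
  rewrite !big_nat; apply: eq_bigr => i lt_i.
  have lt_iS : (i.-1 < size S)%N by rewrite -size_q; clear -le_y lt_i; lia.
  by rewrite /entry q_S (nth_map 0%N).
have -> : sumP d (fun i => (zy < i)%N && (i \notin D)) = \sum_(v <- p | v <= x) v.
  rewrite (sum_sel d (predC (mem D)) (fun v => v <= x)) /sumP big_seq_cond [RHS]big_seq_cond.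
  apply: eq_bigl => i; case: (boolP (i \in _)) => //= i_d.
  by rewrite zy_lt // andbC.
have -> : sumI a my.+1 (size a) = \sum_(v <- a | v <= x) v.
  by rewrite (sum_drop a my (size a)) // -sum_drop_le //; congr (\sum_(_ <- drop _ _) _); clear -a_x; lia.
have zt : zy%:Z + ty = (size e)%:Z - n%:Z + 1.
  rewrite /ty /n size_e; have := countle_perm _ _ x perm_d; rewrite countle_cat.
  by clear -d_x size_d le_y; lia.
rewrite (leE_sumE _ n) //; first last.
- by clear -e_x; lia.
- by rewrite PoszD lerD2l.
(* The entries of [e] after position z_y + m_y are those at most [x]. Adding them to the left side
   gives the n smallest entries of [e]; their parts from [a] and [p] cancel the sums subtracted on
   the right, and the part from [r] stays. *)
have -> : \sum_(v <- drop (zy + my) e) v =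
    \sum_(v <- a | v <= x) v + (\sum_(v <- r | v <= x) v + \sum_(v <- p | v <= x) v).
  rewrite -!big_cat -(perm_big _ perm_e) /= -sum_drop_le //.
  by congr (\sum_(_ <- drop _ _) _); clear -e_x; lia.
rewrite (sum_drop_le r) //.
have shift (s1 s2 s3 s4 s5 : int) : (s1 - (s2 + (s3 + s4)) <= s5 - s4 - s2) = (s1 <= s5 + s3).
  by clear; apply/idP/idP; lia.
by rewrite shift.
Qed.


Lemma condP : greedy a p r q ->
  cond c S d D a e <-> forall u, excess q u <= excess a u + excess p u.
Proof.
move=> gr; rewrite condE; apply: greedy_dominates => //; exact: evals_partition.
Qed.

End Conditions.

(** * The construction of S and Delta *)

Lemma entry_le w (i j : nat) : is_partition w -> (i <= j)%N ->
  i \in iota 1 (size w) -> j \in iota 1 (size w) -> entry w j <= entry w i.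
Proof.
by move=> part_w le_ij; rewrite !mem_iota => i_w j_w; apply: partition_nth => //; lia.
Qed.

Lemma sumP_ext w (P P' : pred nat) : {in iota 1 (size w), P =1 P'} -> sumP w P = sumP w P'.
Proof.
move=> eqP; rewrite /sumP big_seq_cond [RHS]big_seq_cond; apply: eq_bigl => i.
by case: (boolP (i \in _)) => //= /eqP.
Qed.

Lemma cnt_ext (n : nat) (P P' : pred nat) : {in iota 1 n, P =1 P'} -> cnt n P = cnt n P'.
Proof. exact: eq_in_count. Qed.

(** A decision at [j] consults [X] only past [j] and [Y] only at entries below x_j. Hence decisions
    made with the current sets agree with those made with the final ones. *)
Lemma decide_ext (x y u : seq int) (X X' Y Y' : seq nat) (j : nat) :
  is_partition y -> {in iota 1 (size x), forall i, (j < i)%N -> (i \in X) = (i \in X')} ->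
  {in iota 1 (size y), forall i, entry y i < entry x j -> (i \in Y) = (i \in Y')} ->
  decide x X y Y u j = decide x X' y Y' u j.
Proof.
move=> part_y eqX eqY; rewrite /decide.
have eq_notX : {in iota 1 (size x), (fun i : nat => (j < i)%N && (i \notin X)) =1
    (fun i => (j < i)%N && (i \notin X'))}.
  by move=> i i_x /=; case: ltnP => //= lt_ji; rewrite eqX.
have eq_below : {in iota 1 (size y), (fun i : nat => (i \in Y) && (entry y i < entry x j)) =1
    (fun i : nat => (i \in Y') && (entry y i < entry x j))}.
  by move=> i i_y /=; case: ltP => //= lt_i; rewrite ?andbF // eqY.
rewrite (cnt_ext _ _ _ eq_notX) (cnt_ext _ _ _ eq_below) (sumP_ext _ _ _ eq_notX).
rewrite (sumP_ext _ _ _ eq_below) (eq_in_filter eq_below).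
case: ifP => // /negbT le_q; set F := filter _ _.
(* q_j <= s forces an index of [Y] with entry below x_j, so [l] is a genuine index and not the
   default 0. *)
have : (0 < size F)%N.
  have -> : size F = cnt (size y) (fun i => (i \in Y') && (entry y i < entry x j)).
    by rewrite size_filter.
  by move: le_q; rewrite -leNgt; lia.
case def_F: F => [//|l F'] _ /=.
have : l \in F by rewrite def_F mem_head.
rewrite mem_filter => /andP[/andP[_ lt_l] l_y].
have -> : cnt (size y) (fun i => (i \in Y) && (l < i)%N)
  = cnt (size y) (fun i => (i \in Y') && (l < i)%N).
  apply: cnt_ext => i i_y /=; case: ltnP => lt_li; rewrite ?andbF // eqY //.
  by apply: le_lt_trans lt_l; apply: entry_le => //; exact: ltnW.
have -> : cnt (size x) (fun i => (j < i)%N && (i \notin X) && (entry x i < entry y l))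
  = cnt (size x) (fun i => (j < i)%N && (i \notin X') && (entry x i < entry y l)).
  by apply: cnt_ext => i i_x /=; rewrite -(eq_notX i i_x).
by [].
Qed.

(** Processed indices are never revisited, and everything consulted by a decision has been processed
    before it; so the final sets solve the equations given by [decide]. *)
Lemma run_fixpoint c d a b (fuel ic id : nat) (S D : seq nat) :
  is_partition c -> is_partition d -> (ic <= size c)%N -> (id <= size d)%N ->
  (ic + id <= fuel)%N -> {in S, forall i, (ic < i)%N} -> {in D, forall i, (id < i)%N} ->
  let S' := (run c d a b fuel ic id S D).1 in
  let D' := (run c d a b fuel ic id S D).2 in
  [/\ forall i, (ic < i)%N -> (i \in S') = (i \in S),
      forall i, (id < i)%N -> (i \in D') = (i \in D),
      forall i, (0 < i <= ic)%N -> (i \in S') = decide c S' d D' b i &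
      forall i, (0 < i <= id)%N -> (i \in D') = decide d D' c S' a i].
Proof.
move=> part_c part_d.
elim: fuel ic id S D => [|f IH] ic id S D le_ic le_id le_f geS geD /=.
  by split=> // i; lia.
case: ifP => [/andP[/eqP-> /eqP->]|ne0]; first by split=> // i; lia.
case: ifP => [c_min|d_min].
- have ic_gt0 : (0 < ic)%N by lia.
  set dec := decide c S d D b ic; set S1 := (if _ then _ else _).
  have in_S1 i : (i \in S1) = (i == ic) && dec || (i \in S).
    by rewrite /S1; case: ifP => _; rewrite ?inE ?andbT ?andbF.
  have icNS : ic \notin S by apply/negP => /geS; rewrite ltnn.
  have geS1 : {in S1, forall i, (ic.-1 < i)%N}.
    by move=> i; rewrite in_S1 => /orP[/andP[/eqP-> _]|/geS]; lia.
  have [||eqS eqD fixS fixD] := IH ic.-1 id S1 D _ le_id _ geS1 geD; [lia|lia|].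
  move: (run _ _ _ _ _ _ _ _ _) eqS eqD fixS fixD => [S' D'] /= eqS eqD fixS fixD.
  have eqS' i : (ic < i)%N -> (i \in S') = (i \in S).
    by move=> lt_i; rewrite eqS ?in_S1 ?gtn_eqF //; lia.
  split=> // i le_i; have [->|ne_i] := eqVneq i ic; last by apply: fixS; lia.
  rewrite eqS ?in_S1 ?eqxx ?(negPf icNS) ?orbF; last by lia.
  apply: decide_ext => // [k _ lt_k|k k_d lt_k]; first by rewrite eqS'.
  rewrite eqD // ltnNge; apply/negP => le_k.
  have := entry_le d k id part_d le_k k_d; rewrite !mem_iota in k_d *.
  have := c_min; lia.
- have id_gt0 : (0 < id)%N by lia.
  set dec := decide d D c S a id; set D1 := (if _ then _ else _).
  have in_D1 i : (i \in D1) = (i == id) && dec || (i \in D).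
    by rewrite /D1; case: ifP => _; rewrite ?inE ?andbT ?andbF.
  have idND : id \notin D by apply/negP => /geD; rewrite ltnn.
  have geD1 : {in D1, forall i, (id.-1 < i)%N}.
    by move=> i; rewrite in_D1 => /orP[/andP[/eqP-> _]|/geD]; lia.
  have [||eqS eqD fixS fixD] := IH ic id.-1 S D1 le_ic _ _ geS geD1; [lia|lia|].
  move: (run _ _ _ _ _ _ _ _ _) eqS eqD fixS fixD => [S' D'] /= eqS eqD fixS fixD.
  have eqD' i : (id < i)%N -> (i \in D') = (i \in D).
    by move=> lt_i; rewrite eqD ?in_D1 ?gtn_eqF //; lia.
  split=> // i le_i; have [->|ne_i] := eqVneq i id; last by apply: fixD; lia.
  rewrite eqD ?in_D1 ?eqxx ?(negPf idND) ?orbF; last by lia.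
  apply: decide_ext => // [k _ lt_k|k k_c lt_k]; first by rewrite eqD'.
  rewrite eqS // ltnNge; apply/negP => le_k.
  have := entry_le c k ic part_c le_k k_c; rewrite !mem_iota in k_c *.
  have := d_min; lia.
Qed.

Lemma SDelta_fixpoint c d a b : is_partition c -> is_partition d ->
  let S := Sfin c d a b in let D := Dfin c d a b in
  {in iota 1 (size c), forall i, (i \in S) = decide c S d D b i} /\
  {in iota 1 (size d), forall i, (i \in D) = decide d D c S a i}.
Proof.
move=> part_c part_d S D; rewrite /S /D /Sfin /Dfin /SDelta.
have nil_gt (n : nat) : {in ([::] : seq nat), forall i, (n < i)%N} by [].
have := run_fixpoint c d a b (size c + size d) (size c) (size d) [::] [::]
  part_c part_d (leqnn _) (leqnn _) (leqnn _) (nil_gt _) (nil_gt _).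
move: (run _ _ _ _ _ _ _ _ _) => [S' D'] /= [_ _ fixS fixD].
have memS : {in iota 1 (size c), forall i,
    (i \in [seq i <- iota 1 (size c) | i \in S']) = (i \in S')}.
  by move=> i i_c; rewrite mem_filter i_c andbT.
have memD : {in iota 1 (size d), forall i,
    (i \in [seq i <- iota 1 (size d) | i \in D']) = (i \in D')}.
  by move=> i i_d; rewrite mem_filter i_d andbT.
split=> i i_w; [rewrite memS // fixS|rewrite memD // fixD];
  try (by move: i_w; rewrite mem_iota; lia);
  by apply: decide_ext => // k k_w _; rewrite ?memS ?memD.
Qed.

(** Turns membership among the N smallest entries in rule (a) into a count: without repetitions, the
    elements related to [z] by [le] are [z] and those after it. *)
Lemma mem_drop_sorted (T : eqType) (le : rel T) (s : seq T) z (n : nat) :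
  total le -> antisymmetric le -> transitive le -> uniq s -> sorted le s -> z \in s ->
  (z \in drop n s) = (n + count (le z) s <= size s)%N.
Proof.
move=> le_total le_anti le_trans uniq_s sorted_s zs.
case/splitPr: zs uniq_s sorted_s => s1 s2.
rewrite cat_uniq /= => /and3P[_ /norP[zNs1 _] /andP[zNs2 _]] sorted_s.
have le_refl (x : T) : le x x by have := le_total x x; rewrite orbb.
have c1 : count (le z) s1 = 0%N.
  apply/eqP; rewrite -leqn0 leqNgt -has_count; apply/hasPn => x xs1.
  apply: contraNN zNs1 => le_zx; suff -> : z = x by [].
  apply: le_anti; rewrite le_zx /=; move: sorted_s; rewrite (sorted_pairwise le_trans).
  rewrite pairwise_cat => /and3P[/allrelP h _ _]; exact: h (mem_head _ _).
have c2 : count (le z) s2 = size s2.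
  apply/eqP; rewrite -all_count; move: sorted_s; rewrite (sorted_pairwise le_trans).
  by rewrite pairwise_cat /= => /and4P[].
rewrite count_cat size_cat /= c1 c2 le_refl drop_cat.
case: ltnP => lt_n; first by rewrite mem_cat mem_head orbT; lia.
have [->|ne] := eqVneq n (size s1); first by rewrite subnn drop0 mem_head; lia.
have -> : (n - size s1 = (n - size s1).-1.+1)%N by lia.
have /negPf zN : z \notin drop (n - size s1).-1 s2 by apply: contra zNs2; apply: mem_drop.
by rewrite /= zN; lia.
Qed.

Lemma count_gt_index (s : seq nat) (i : nat) : sorted ltn s -> (i < size s)%N ->
  count (fun k => (nth 0 s i < k)%N) s = (size s - i.+1)%N.
Proof.
elim: s i => //= x s IH [|i] path_s lt_i.
  rewrite ltnn add0n subn1 /=; apply/eqP; rewrite -all_count.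
  exact: order_path_min ltn_trans path_s.
rewrite IH ?(path_sorted path_s) // subSS.
have /allP/(_ (nth 0%N s i)) := order_path_min ltn_trans path_s.
by rewrite mem_nth // => /(_ isT) lt_x; rewrite ltnNge ltnW //=.
Qed.

Lemma cnt_split (n : nat) (P Q : pred nat) :
  cnt n P = (cnt n (fun i => P i && Q i) + cnt n (fun i => P i && ~~ Q i))%N.
Proof.
rewrite /cnt; elim: (iota 1 n) => //= i s ->.
by case: (P i); case: (Q i) => /=; lia.
Qed.

Lemma ecmp_anti : antisymmetric ecmp.
Proof.
move=> [x [b i]] [y [b' j]]; rewrite /ecmp /=.
case: b b' => -[] /= h; try (exfalso; lia);
  by have [-> ->] : x = y /\ i = j by lia.
Qed.

Lemma etag_uniq w w' : uniq (etag w w').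
Proof.
have inj (t : bool) (u : seq int) : injective (fun i => (entry u i, (t, i))) by move=> i j [].
rewrite /etag sort_uniq cat_uniq !(map_inj_uniq (inj _ _)) !iota_uniq andbT /=.
by apply/hasPn => z /mapP[i _ ->]; apply/mapP => -[j _ []].
Qed.

Lemma etag_count w w' (P : pred (int * (bool * nat))) :
  count P (etag w w') = (cnt (size w) (fun i => P (entry w i, (false, i)))
    + cnt (size w') (fun i => P (entry w' i, (true, i))))%N.
Proof.
by rewrite /etag count_sort count_cat !count_map.
Qed.

Lemma count_entry w (P : pred int) : cnt (size w) (fun i => P (entry w i)) = count P w.
Proof. by rewrite -[in RHS](map_entry w) count_map. Qed.

Lemma cnt_eq1 (n k : nat) (P : pred nat) : k \in iota 1 n ->
  {in iota 1 n, forall i : nat, P i = (i == k)} -> cnt n P = 1%N.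
Proof.
move=> k_n eqP; rewrite (cnt_ext n P (pred1 k)) //.
by rewrite /cnt (count_uniq_mem k (iota_uniq 1 n)) k_n.
Qed.

Lemma entry_in w (i : nat) : i \in iota 1 (size w) -> entry w i \in w.
Proof.
rewrite mem_iota => i_w; have lt_i : (i.-1 < size w)%N by lia.
exact: mem_nth.
Qed.

(** * Rules (a) and (b) in terms of height and slack *)

Section Rule.

Variables (a c d : seq int) (S D : seq nat).
Hypotheses (part_a : is_partition a) (part_c : is_partition c) (part_d : is_partition d).
Hypothesis disjoint_cd : forall v, v \in c -> v \notin d.
Hypothesis D_fix : {in iota 1 (size d), forall i, (i \in D) = decide d D c S a i}.

(** With these counts q_j = size a - below j + kept j + 1, and q_j <= above j says that a_(q_j) >=
    d_j, where a_i = +oo for i <= 0. *)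
Let below (j : nat) : nat := cnt (size c) (fun i => (i \in S) && (entry c i < entry d j)).
Let kept (j : nat) : nat := cnt (size d) (fun i => (j < i)%N && (i \notin D)).
Let above (j : nat) : nat := count (fun v => entry d j <= v) a.

(* The rule (a) of the construction: with [l] the least index in [S] such that
   [c_l < d_j], it asks whether [a_(q_j) >= d_j] up to a correction that
   [decide_rule] shows to be irrelevant. *)
Lemma rule_a (j : nat) : j \in iota 1 (size d) -> (kept j < below j)%N ->
  exists l : nat, [/\ l \in iota 1 (size c), entry c l < entry d j,
    forall i, i \in iota 1 (size c) -> i \in S -> entry c i < entry d j -> (l <= i)%N &
    decide d D c S a j =
      if (size a + kept j + 1 + cnt (size d) (fun i => (j < i)%N && (i \in D)
            && (entry c l < entry d i)%R) <= above j + below j)%N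
      then false
      else ~~ leE (addFE (sumP d (fun i => (j < i)%N && (i \notin D)) + entry d j)
              (sumE a ((size a)%:Z - (below j)%:Z + (kept j)%:Z + 1 + 1) (size a)%:Z))
           (Fin (sumP c (fun i => (i \in S) && (entry c i < entry d j))))].
Proof.
move=> j_d lt_kb; rewrite /decide -/(below j) -/(kept j).
rewrite ifF; last by lia.
set F := filter _ _.
have : (0 < size F)%N.
  have -> : size F = below j by rewrite size_filter.
  exact: leq_ltn_trans lt_kb.
case def_F: F => [//|l F'] _ /=.
have : l \in F by rewrite def_F mem_head.
rewrite mem_filter => /andP[/andP[l_S lt_l] l_c].
have min_l i : i \in iota 1 (size c) -> i \in S -> entry c i < entry d j -> (l <= i)%N.
  move=> i_c i_S lt_i.
  have : i \in F by rewrite mem_filter i_S lt_i.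
  rewrite def_F inE => /orP[/eqP-> //|i_F'].
  have : sorted ltn F by apply: sorted_filter (iota_ltn_sorted _ _); apply: ltn_trans.
  by rewrite def_F /= => /(order_path_min ltn_trans)/allP/(_ i i_F')/ltnW.
exists l; split=> //; congr (if _ then _ else _).
set cl := entry c l in lt_l *.
have cl_d i : i \in iota 1 (size d) -> entry d i != cl.
  move=> i_d; apply: contraTneq (entry_in d i i_d) => ->.
  by apply: disjoint_cd; apply: entry_in.
have -> : cnt (size c) (fun i => (i \in S) && (l < i)%N) = (below j).-1.
  suff -> : below j = (cnt (size c) (fun i => (i \in S) && (l < i)%N) + 1)%N by rewrite addn1.
  rewrite /below (cnt_split _ _ (fun i => l < i)%N); congr addn.
    apply: cnt_ext => i i_c /=.
    case: (ltnP l i) => lt_li; rewrite ?andbF // !andbT.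
    rewrite (le_lt_trans _ lt_l) ?andbT //; apply: entry_le => //; exact: ltnW.
  apply: (cnt_eq1 _ l) => // i i_c /=; have [->|ne_il] := eqVneq i l.
    by rewrite l_S lt_l ltnn.
  apply/negP => /andP[/andP[i_S lt_i] /negP[]].
  by rewrite ltn_neqAle eq_sym ne_il min_l.
set z := (entry d j, (true, j)); set L := [seq _ <- _ | _].
have zL : z \in L.
  rewrite mem_filter lt_l mem_sort mem_cat; apply/orP; right.
  by apply/mapP; exists j.
have uniq_L : uniq L by rewrite filter_uniq // etag_uniq.
have sorted_L : sorted ecmp L by apply: (sorted_filter ecmp_trans); apply: sort_sorted ecmp_total _.
rewrite (mem_drop_sorted _ ecmp) //; [|exact: ecmp_total|exact: ecmp_anti|exact: ecmp_trans].
(* From d_j on, the list has the [a]-entries strictly between c_l and d_j, since equal ones are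
   placed earlier, then d_j itself and the d_i above c_l with i > j. *)
have count_L : count (ecmp z) L = (count (fun v => (cl < v) && (v < entry d j))%R a
    + (cnt (size d) (fun i => (j < i)%N && (cl < entry d i)%R)).+1)%N.
  rewrite count_filter etag_count; congr addn.
    rewrite -(count_entry a); apply: cnt_ext => i _ /=.
    by rewrite /ecmp /= andbF orbF andbC.
  rewrite (cnt_split _ _ (fun i => j < i)%N) addnC -[RHS]add1n; congr addn.
    apply: (cnt_eq1 _ j) => // i i_d /=; have [->|ne_ij] := eqVneq i j.
      by rewrite /ecmp /= eqxx leqnn lt_l ltnn orbT.
    apply/negP => /andP[/andP[]]; rewrite /ecmp /= => le_ij lt_cl /negP[].
    case: (leqP i j) => // le_ij'; have := entry_le d i j part_d le_ij' i_d j_d.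
    by clear -le_ij ne_ij le_ij'; lia.
  apply: cnt_ext => i i_d /=; case: (ltnP j i) => lt_ji; rewrite ?andbF // !andbT.
  have := entry_le d j i part_d (ltnW lt_ji) j_d i_d.
  by rewrite /ecmp /= (ltnW lt_ji) andbT le_eqVlt eq_sym orbC => ->.
have a_split : count (fun v => cl < v) a
    = (count (fun v => (cl < v) && (v < entry d j))%R a + above j)%N.
  rewrite /above -!count_entry (cnt_split _ _ (fun i => entry a i < entry d j)); congr addn.
  apply: cnt_ext => i _ /=; rewrite -leNgt andb_idl // => le_ai.
  exact: lt_le_trans lt_l le_ai.
have d_split := cnt_split (size d) (fun i => (j < i)%N && (cl < entry d i)) (fun i => i \in D).
have k_split : kept j = _ := cnt_split (size d) _ (fun i => cl < entry d i).
have eqB : cnt (size d) (fun i => (j < i)%N && (i \in D) && (cl < entry d i))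
    = cnt (size d) (fun i => (j < i)%N && (cl < entry d i) && (i \in D)).
  by apply: cnt_ext => i _ /=; rewrite andbAC.
have eq_r1 : cnt (size d) (fun i => (j < i)%N && (i \notin D) && (cl < entry d i))
    = cnt (size d) (fun i => (j < i)%N && (cl < entry d i) && (i \notin D)).
  by apply: cnt_ext => i _ /=; rewrite andbAC.
have eq_r2 : cnt (size d) (fun i => (j < i)%N && (i \notin D) && (entry d i < cl))
    = cnt (size d) (fun i => (j < i)%N && (i \notin D) && ~~ (cl < entry d i)).
  by apply: cnt_ext => i i_d /=; rewrite -leNgt le_eqVlt (negPf (cl_d i i_d)).
have le_L := count_size (ecmp z) L.
rewrite count_L eqB eq_r2 in le_L *.
have {}k_split := etrans k_split (f_equal2 addn eq_r1 (erefl _)).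
have lt_kb' : (kept j < below j)%N := lt_kb.
move: le_L lt_kb'; rewrite a_split d_split k_split.
move: (size L) (below j) (above j) (size a) (count _ _).
move: (cnt (size d) (fun i => (j < i)%N && (cl < entry d i) && (i \in D))).
move: (cnt (size d) (fun i => (j < i)%N && (cl < entry d i) && (i \notin D))).
move: (cnt (size d) (fun i => (j < i)%N && (i \notin D) && ~~ (cl < entry d i))).
clear; move=> r2 r1 B sL bj aj sa ca le_L lt_kb.
by apply/idP/idP; lia.
Qed.

Lemma sumE_drop w (n : nat) : (n <= size w)%N ->
  sumE w (n%:Z + 1) (size w)%:Z = Fin (\sum_(v <- drop n w) v).
Proof.
rewrite leq_eqVlt => /orP[/eqP->|lt_n]; rewrite /sumE.
  by rewrite ifT ?drop_size ?big_nil //; lia.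
rewrite ifF; last by lia.
rewrite ifF; last by lia.
rewrite ifF; last by lia.
have -> : absz (n%:Z + 1) = n.+1 by lia.
by rewrite sum_drop.
Qed.

Let q_ (j : nat) : nat := (size a + kept j + 1 - below j)%N.

(** Failure of the inequality in rule (b). *)
Let bad (j : nat) : bool :=
  sumP c (fun i => (i \in S) && (entry c i < entry d j))
    < sumP d (fun i => (j < i)%N && (i \notin D)) + entry d j + \sum_(v <- drop (q_ j) a) v.

(** The correction in rule (a) counts the i > j in [D] with d_i > c_l. By induction such an i has
    a_(q_i) < d_i; but [below] is the same at i and j, [kept] is no larger at i and [above] no
    smaller, so a_(q_j) >= d_j excludes it. *)
Lemma decide_rule (j : nat) : j \in iota 1 (size d) ->
  decide d D c S a j = (above j + below j < size a + kept j + 1)%N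
    && ((kept j < below j)%N ==> bad j).
Proof.
have [n] := ubnP (size d - j)%N; elim: n j => // n IH j lt_n j_d.
have above_le : (above j <= size a)%N := count_size _ _.
case: (ltnP (kept j) (below j)) => [lt_kb|le_bk] /=; last first.
  rewrite andbT /decide -/(below j) -/(kept j) ifT.
    by apply/esym; clear -above_le le_bk; lia.
  by clear -le_bk; lia.
have [l [l_c lt_l min_l ->]] := rule_a j j_d lt_kb.
set B := cnt _ _.
case: (ltnP (above j + below j) (size a + kept j + 1)) => [lt_q|le_q] /=.
  rewrite ifF; last by clear -lt_q; lia.
  (* Here q_j > above j, so the truncated subtraction in [q_] is exact. *)
  have -> : (size a)%:Z - (below j)%:Z + (kept j)%:Z + 1 + 1 = (q_ j)%:Z + 1.
    by rewrite /q_; clear -lt_kb lt_q; lia.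
  rewrite sumE_drop /=; last by rewrite /q_; clear -lt_kb; lia.
  by rewrite -ltNge.
rewrite ifT //; suff -> : B = 0%N by rewrite addn0.
apply/eqP; rewrite -leqn0 leqNgt /B /cnt -has_count; apply/hasPn => i i_d.
apply/negP => /andP[/andP[lt_ji i_D] lt_li].
move: i_D; rewrite D_fix // IH //; last first.
  by move: i_d j_d; rewrite !mem_iota; clear -lt_n lt_ji; lia.
case/andP=> lt_i _.
have le_ij := entry_le d j i part_d (ltnW lt_ji) j_d i_d.
have eq_below : below i = below j.
  apply: cnt_ext => k k_c /=; case: (boolP (k \in S)) => //= k_S.
  apply/idP/idP => [lt_k|lt_k]; first exact: lt_le_trans lt_k le_ij.
  by apply: le_lt_trans lt_li; apply: entry_le (min_l k k_c k_S lt_k) l_c k_c.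
have le_kept : (kept i <= kept j)%N.
  by apply: sub_count => k /= /andP[lt_k ->]; rewrite (ltn_trans lt_ji lt_k).
have le_above : (above j <= above i)%N.
  by apply: sub_count => v /=; apply: le_trans.
by clear -lt_i eq_below le_kept le_above le_q; lia.
Qed.

Lemma mem_D (j : nat) : j \in iota 1 (size d) ->
  (j \in D) = (above j + below j < size a + kept j + 1)%N
    && ((kept j < below j)%N ==> bad j).
Proof. by move=> j_d; rewrite D_fix // decide_rule. Qed.

Let q := sel c (mem S).
Let r := sel d (mem D).
Let p := sel d (predC (mem D)).

Lemma above_countle (j : nat) : (above j + countle a (entry d j - 1) = size a)%N.
Proof.
rewrite addnC -[RHS](countle_gt a (entry d j - 1)); congr addn.
by apply: eq_count => v /=; clear; lia.
Qed.

Lemma below_countle (j : nat) : below j = countle q (entry d j - 1).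
Proof.
rewrite /countle (count_sel c (mem S) (fun v => v <= entry d j - 1)).
by apply: cnt_ext => i _ /=; congr andb; clear; lia.
Qed.

Lemma below_countle_eq (j : nat) : j \in iota 1 (size d) -> below j = countle q (entry d j).
Proof.
move=> j_d; rewrite below_countle [RHS]countle_notin //.
apply/negP => /mapP[i]; rewrite mem_filter => /andP[_ i_c] eq_ij.
have := disjoint_cd _ (entry_in _ _ i_c); rewrite -eq_ij.
by rewrite entry_in.
Qed.

Lemma kept_countle (j : nat) : j \in iota 1 (size d) -> (kept j <= countle p (entry d j))%N.
Proof.
move=> j_d; rewrite /countle (count_sel d (predC (mem D)) (fun v => v <= entry d j)).
rewrite /kept /cnt -!size_filter; apply: uniq_leq_size.
  by rewrite filter_uniq ?iota_uniq.
move=> i; rewrite !mem_filter /= => /andP[/andP[lt_ji ->] i_d].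
by rewrite i_d /= andbT entry_le // ltnW.
Qed.

Lemma cntE (n : nat) (P : pred nat) : (cnt n P)%:Z = \sum_(i <- iota 1 n) (P i)%:Z.
Proof.
rewrite /cnt; elim: (iota 1 n) => [|i s IH]; first by rewrite big_nil.
by rewrite big_cons /= PoszD IH.
Qed.

Lemma excess_sel w (P : pred nat) x : excess (sel w P) x =
  \sum_(i <- iota 1 (size w) | P i && (entry w i <= x)) (x - entry w i).
Proof. by rewrite /excess /sel big_map big_filter_cond. Qed.

(** In psi_(q_j)(d_j) the coefficient of d_j is (s - q_j) + kept j - below j = -1, which supplies
    the summand d_j of rule (b). Kept indices up to j with value d_j contribute 0. *)
Lemma slack_bad (j : nat) : j \in iota 1 (size d) ->
  (kept j < below j <= size a + kept j + 1)%N ->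
  bad j = (slack a p q (q_ j) (entry d j) < 0).
Proof.
move=> j_d /andP[lt_kb le_b]; set x := entry d j.
have ex_p : excess p x = x * (kept j)%:Z - sumP d (fun i => (j < i)%N && (i \notin D)).
  rewrite excess_sel /sumP big_mkcond [X in _ = _ - X]big_mkcond cntE mulr_sumr -sumrB.
  rewrite !big_seq; apply: eq_bigr => i i_d /=.
  case: (i \in D) => /=; first by rewrite andbF mulr0 subr0.
  rewrite !andbT; case: (ltnP j i) => [lt_ji|le_ij].
    by rewrite (entry_le d j i) ?mulr1 // ltnW.
  have := entry_le d i j part_d le_ij i_d j_d; rewrite -/x => le_x.
  by rewrite mulr0 subr0; case: ifP => //; clear -le_x; lia.
have ex_q : excess q x = x * (below j)%:Z - sumP c (fun i => (i \in S) && (entry c i < x)).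
  rewrite excess_sel /sumP big_mkcond [X in _ = _ - X]big_mkcond cntE mulr_sumr -sumrB.
  apply: eq_bigr => i _; rewrite /= -/x.
  case: (i \in S) => //=; last by rewrite mulr0 subr0.
  by case: (ltgtP (entry c i) x) => [lt_x|lt_x|->]; rewrite ?mulr1 ?mulr0 ?subr0 ?subrr.
rewrite /bad -/x /slack tail_sum ex_p ex_q.
have -> : (size a - q_ j)%N%:Z = (below j)%:Z - (kept j)%:Z - 1 by rewrite /q_; clear -lt_kb le_b; lia.
have shift (s1 s2 s3 k1 k2 : int) : (s1 < s2 + x + s3) =
    (x * (k1 - k2 - 1) - s3 + (x * k2 - s2) - (x * k1 - s1) < 0).
  by clear; apply/idP/idP; lia.
exact: shift.
Qed.

(** The height bound comes from kept j < below j at every kept index. Rules (a) and (b) give the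
    alternatives of [greedy_keep], and their joint failure gives [greedy_drop] at the level q_j. *)
Lemma greedy_sel : greedy a p r q.
Proof.
split=> [x|t x t_gt0 /andP[lt_h le_h]|x].
- suff : (countle p x <= countle q x)%N by rewrite /height; lia.
  rewrite {1}/countle (count_sel d (predC (mem D)) (fun v => v <= x)) /cnt -size_filter.
  set F := filter _ _; case def_F: F => [//|j F'] /=.
  have sorted_F : sorted ltn F by apply: (sorted_filter ltn_trans); apply: iota_ltn_sorted.
  have : j \in F by rewrite def_F mem_head.
  rewrite mem_filter => /andP[/andP[/= jND le_jx] j_d].
  have le_F' : (size F' <= kept j)%N.
    rewrite /kept /cnt -size_filter; apply: uniq_leq_size => [|i i_F'].
      have : uniq F by rewrite filter_uniq ?iota_uniq.
      by rewrite def_F /= => /andP[].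
    move: sorted_F; rewrite def_F /= => /(order_path_min ltn_trans)/allP/(_ i i_F') lt_ji.
    have : i \in F by rewrite def_F inE i_F' orbT.
    by rewrite !mem_filter /= => /andP[/andP[-> _] ->]; rewrite lt_ji.
  have le_above : (above j <= size a)%N := count_size _ _.
  have lt_kb : (kept j < below j)%N.
    move: jND; rewrite mem_D // negb_and -leqNgt => /orP[le_q|].
      by clear -le_q le_above; lia.
    by case: (kept j < below j)%N.
  have := countle_homo q _ _ le_jx; rewrite -below_countle_eq //.
  by clear -lt_kb le_F'; lia.
- pose I : seq nat := [seq i <- iota 1 (size d) | i \notin D].
  have size_I : size I = size p by rewrite size_map.
  (* Chosen so that q_j = t for the kept index j followed by exactly [k] kept indices; as phi
     reaches t at [x], [countle p (x - 1) <= k < countle p x], and so d_j = x. *)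
  pose k := (t + countle q x - size a).-1.
  have le_qx : (countle q (x - 1) <= countle q x)%N by apply: countle_homo; clear; lia.
  have le_px := countle_leq_size p x.
  have def_k : k.+1%:Z = t%:Z + (countle q x)%:Z - (size a)%:Z.
    by move: lt_h; rewrite /k /height; clear -le_qx; lia.
  have lt_kp : (k < countle p x)%N by move: le_h; rewrite /height; clear -def_k; lia.
  have le_pk : (countle p (x - 1) <= k)%N.
    by move: lt_h; rewrite /height; clear -def_k le_qx; lia.
  pose i0 := (size I - k.+1)%N.
  have lt_i0 : (i0 < size I)%N by rewrite /i0; clear -lt_kp le_px size_I; lia.
  pose j := nth 0%N I i0.
  have : j \in I by rewrite mem_nth.
  rewrite mem_filter => /andP[jND j_d].
  have part_p : is_partition p := sel_partition d _ part_d.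
  have nth_p : nthz p i0 = entry d j by rewrite (nth_map 0%N).
  have dj : entry d j = x.
    have lt_ip : (i0 < size p)%N by rewrite -size_I.
    have := partition_nth_le p i0 x part_p lt_ip.
    have := partition_nth_le p i0 (x - 1) part_p lt_ip.
    by rewrite nth_p /i0 size_I; clear -lt_kp le_pk le_px; lia.
  have kept_j : kept j = k.
    have -> : kept j = count (fun i => j < i)%N I by rewrite /kept /cnt count_filter.
    rewrite count_gt_index //; first by rewrite /i0; clear -lt_kp le_px size_I; lia.
    by apply: (sorted_filter ltn_trans); apply: iota_ltn_sorted.
  have below_j : below j = countle q x by rewrite below_countle_eq ?dj.
  have above_j := above_countle j; rewrite dj in above_j.
  move: jND; rewrite mem_D // negb_and -leqNgt negb_imply => /orP[le_q|/andP[lt_kb nbad]].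
    by left; clear -le_q above_j kept_j below_j def_k; lia.
  right; move: nbad; rewrite slack_bad //; last first.
    by rewrite lt_kb; clear -kept_j below_j def_k; lia.
  by rewrite dj -leNgt; have -> : q_ j = t by rewrite /q_; clear -kept_j below_j def_k; lia.
- move=> /mapP[j]; rewrite mem_filter => /andP[j_D j_d] ->.
  move: j_D; rewrite /= mem_D // => /andP[lt_q bad_j].
  have above_j := above_countle j.
  have below_j := below_countle_eq j j_d.
  have kept_j := kept_countle j j_d.
  have le_above : (above j <= size a)%N := count_size _ _.
  exists (q_ j); split.
  + by rewrite /height -below_j /q_; clear -lt_q kept_j; lia.
  + by rewrite /q_; clear -above_j lt_q; lia.
  + move=> le_q; have lt_kb : (kept j < below j)%N by move: le_q; rewrite /q_; clear -lt_q; lia.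
    rewrite -slack_bad //; first by move: bad_j; rewrite lt_kb.
    by rewrite lt_kb; clear -lt_q; lia.
Qed.

End Rule.

Theorem theorem4p1 (m n s k : nat) (a b c d : seq int) :
  (0 < m)%N -> (0 < n)%N -> (0 < s)%N -> (0 < k)%N -> (m + s = n + k)%N ->
  size a = s -> size b = k -> size c = n -> size d = m ->
  is_partition a -> is_partition b -> is_partition c -> is_partition d ->
  (forall i j, (1 <= i <= n)%N -> (1 <= j <= m)%N -> entry c i != entry d j) ->
  (exists g : seq int, is_partition g /\ weak_major g d a /\ weak_major g c b) <->
  (cond c (Sfin c d a b) d (Dfin c d a b) a (evals a d) /\
   cond d (Dfin c d a b) c (Sfin c d a b) b (evals b c)).
Proof.
move=> _ _ _ _ eq_sz size_a size_b size_c size_d part_a part_b part_c part_d ne_cd.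
have disj_cd v : v \in c -> v \notin d.
  move=> /(nthP (0 : int))[i lt_i <-]; apply/negP => /(nthP (0 : int))[j lt_j eq_ji].
  have := ne_cd i.+1 j.+1; rewrite -size_c -size_d /entry /= eq_ji eqxx.
  by move=> /(_ lt_i lt_j).
have disj_dc v : v \in d -> v \notin c by move=> vd; apply: contraTN vd; apply: disj_cd.
have [S_fix D_fix] := SDelta_fixpoint c d a b part_c part_d.
have S_sub : Sfin c d a b = [seq i <- iota 1 (size c) | i \in Sfin c d a b].
  by apply: eq_in_filter => i i_c; rewrite mem_filter i_c andbT.
have D_sub : Dfin c d a b = [seq i <- iota 1 (size d) | i \in Dfin c d a b].
  by apply: eq_in_filter => i i_d; rewrite mem_filter i_d andbT.
(* From here on the construction enters only through its fixpoint equations and the ordering of both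
   index lists. *)
move: (Sfin c d a b) (Dfin c d a b) S_fix D_fix S_sub D_sub => S D S_fix D_fix S_sub D_sub.
have gr_a := greedy_sel a c d S D part_a part_c part_d disj_cd D_fix.
have gr_b := greedy_sel b d c D S part_b part_d part_c disj_dc S_fix.
have perm_d := sel_perm d (mem D); have perm_c := sel_perm c (mem S).
rewrite (condP a c d S D) // (condP b d c D S) //.
split=> [[g [part_g [maj_d maj_c]]]|[dom_a dom_b]]; last first.
  by apply: greedy_exists gr_a gr_b perm_d perm_c dom_a dom_b => //; lia.
have size_gd : size g = (size d + size a)%N by case: maj_d.
have size_gc : size g = (size c + size b)%N by case: maj_c.
have h_d x := weak_major_height _ _ g d a erefl erefl size_gd part_d part_g x maj_d.
have h_c x := weak_major_height _ _ g c b erefl erefl size_gc part_c part_g x maj_c.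
have V_d x := weak_major_slack _ _ g d a erefl erefl size_gd part_d part_g x maj_d.
have V_c x := weak_major_slack _ _ g c b erefl erefl size_gc part_c part_g x maj_c.
(* The selected tail never has more entries up to a bound than [g], which forces both
   dominations. *)
have le_g := greedy_le _ _ _ _ _ _ _ _ _ part_a part_b gr_a gr_b perm_d perm_c h_d V_d h_c V_c.
split=> u.
  have [j [_ _ slack_j]] := V_d u.
  by apply: slack_excess perm_d _ slack_j => t _; apply: le_g.
have [j [_ _ slack_j]] := V_c u.
apply: slack_excess perm_c _ slack_j => t _.
by apply: leq_trans (le_g t); rewrite !countle_cat addnC.
Qed.
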